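(* Let $1\le d<\infty$ be an integer and let $X,X_n,Y$ be random variables in $\mathbb{R}^d$. (a) Let $\{X_n\}$ satisfy $E\|X_n\|<\infty$ for all $n\ge1$. Then the following are equivalent: (i) $W_1(X_n,X)\to0$; (ii) $W_1^*(X_n,X)\to0$; (iii) for every $f\in D_d$, $Ef(X_n)\to Ef(X)<\infty$. (b) For any $\epsilon>0$, let $T_\epsilon\subset S_d$ be a finite subset satisfying $\sup_{s\in S_d}\inf_{t\in T_\epsilon}\|s-t\|\le\epsilon$. Then $$\Big|W_1^*(X,Y)-\sup_{t\in T_\epsilon}W_1(t'X,t'Y)\Big|\le\epsilon\big(E\|X\|+E\|Y\|\big).$$
   Context: $\|\cdot\|$ is the Euclidean norm. $W_1(X,Y)=\inf_{\lambda\in\Gamma(X,Y)}E_\lambda\|X-Y\|$, where $\Gamma(X,Y)$ is the set of joint laws with marginals the laws of $X$ and $Y$ (for scalar random variables the norm is the absolute value). $S_d=\{t\in\mathbb{R}^d:\|t\|=1\}$, and the max-sliced Wasserstein distance is $W_1^*(X,Y)=\sup_{t\in S_d}W_1(t'X,t'Y)$. $D_d$ is the set of all continuous $f:\mathbb{R}^d\to\mathbb{R}$ with $\sup_{z\in\mathbb{R}^d}|f(z)|/(1\vee\|z\|)<\infty$. *)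

(* Defs.v *)
From HB Require Import structures.
From mathcomp Require Import all_boot all_order all_algebra.
From mathcomp Require Import all_classical all_reals all_analysis.

Set Implicit Arguments.
Unset Strict Implicit.
Unset Printing Implicit Defensive.

Import Order.TTheory GRing.Theory Num.Theory.
Import numFieldTopology.Exports numFieldNormedType.Exports.
Local Open Scope classical_set_scope.
Local Open Scope ring_scope.

(* R^d : row vectors of length d with the Borel sigma-algebra, i.e. the
   sigma-algebra generated by the open sets of the (product = Euclidean)
   topology of 'rV[R]_d. *)
Definition Rd (R : realType) (d : nat) :=
  g_sigma_algebraType (@open 'rV[R]_d).

Definition enorm {R : realType} {d : nat} (x : 'rV[R]_d) : R :=
  Num.sqrt (\sum_(i < d) x 0 i ^+ 2).

Definition dotv {R : realType} {d : nat} (t x : 'rV[R]_d) : R :=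
  \sum_(i < d) t 0 i * x 0 i.

Definition sphere (R : realType) (d : nat) : set 'rV[R]_d :=
  [set t | enorm t = 1].
Arguments sphere : clear implicits.

Definition coupling {R : realType} {dT} {T : measurableType dT}
  {dU} {U : measurableType dU} (P : probability T R) (X Y : T -> U)
  (lam : probability (U * U)%type R) : Prop :=
  forall A : set U, measurable A ->
    lam (fst @^-1` A) = P (X @^-1` A) /\ lam (snd @^-1` A) = P (Y @^-1` A).

Definition W1c {R : realType} {dT} {T : measurableType dT}
  {dU} {U : measurableType dU} (c : U -> U -> R) (P : probability T R)
  (X Y : T -> U) : \bar R :=
  ereal_inf [set (\int[lam]_z (c z.1 z.2)%:E)%E
            | lam in [set lam | coupling P X Y lam]].

Definition W1 {R : realType} {d : nat} {dT} {T : measurableType dT}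
  (P : probability T R) (X Y : T -> Rd R d) : \bar R :=
  W1c (fun x y : Rd R d => enorm (x - y)) P X Y.

Definition W1r {R : realType} {dT} {T : measurableType dT}
  (P : probability T R) (X Y : T -> R) : \bar R :=
  W1c (fun x y : R => `|x - y|) P X Y.

Definition W1star {R : realType} {d : nat} {dT} {T : measurableType dT}
  (P : probability T R) (X Y : T -> Rd R d) : \bar R :=
  ereal_sup [set W1r P (fun w => dotv t (X w)) (fun w => dotv t (Y w))
            | t in sphere R d].

Definition Dd (R : realType) (d : nat) : set ('rV[R]_d -> R) :=
  [set f | continuous f /\
     exists C : R, forall z, `|f z| <= C * Num.max 1 (enorm z)].
Arguments Dd : clear implicits.
Arguments Rd : clear implicits.

(* Main.v *)
(* A ridge function is a map x |-> h (t'x) with |t| = 1 and h >= 0 Lipschitz.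
   Each of (i), (ii), (iii) forces E h(t'X_n) -> E h(t'X) for all ridge
   functions, together with integrability of X.  Conversely this suffices.
   Trigonometric polynomials are sums of ridge functions (up to constants) and
   form an algebra, so E g(X_n) -> E g(X) for each of them.  Substituting
   (1 + sin (x_i / L)) / 2 into the Bernstein weights gives a partition of
   unity made of trigonometric polynomials, concentrated near finitely many
   nodes as long as x stays in the box [-L, L]^d; outside of the box everything
   is controlled by the ridge functions max(|x_i| - L/2, 0).
   This partition approximates any f in D_d, which gives (iii).  Coupling X_n
   and X cell by cell, with the small mass left over coupled independently,
   gives W1(X_n, X) -> 0, which is (i).

   For (b), the triangle inequality for W1 needs couplings to be glued.  The
   same cell-by-cell coupling, applied to two variables with the same law,
   glues them up to an arbitrarily small error, without disintegration. *)
Require Import Defs.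
From HB Require Import structures.
From mathcomp Require Import all_boot all_order all_algebra.
From mathcomp Require Import all_classical all_reals all_analysis.
From mathcomp Require Import measurable_realfun.
From mathcomp Require Import ring lra.

Set Implicit Arguments.
Unset Strict Implicit.
Unset Printing Implicit Defensive.

Import Order.TTheory GRing.Theory Num.Theory.
Import numFieldTopology.Exports numFieldNormedType.Exports.
Local Open Scope classical_set_scope.
Local Open Scope ring_scope.

(** A ridge function sees one direction only, while a cell of R^d involves all coordinates at once,
    and a product of functions of different coordinates is not a ridge function. Cosines escape this
    obstacle: cos u cos v = (cos (u + v) + cos (u - v)) / 2 turns a product back into a sum of ridge
    functions, with oblique directions. This is why directions other than the axes matter.
    Hypothesis (ii) enters through each fixed direction t.

    The sine is injective on [-1, 1], which keeps the cells small inside the box; beyond it,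
    periodicity sends points to wrong nodes. The nodes stay in the box, however, so the error there
    is at most a multiple of the excess of |x_i| over L / 2, and that excess is itself a ridge
    function. Cutting at L / 2 instead of L makes the excess larger than L / 2 as soon as |x_i| > L,
    so that it pays for bounded errors too. *)

(** * Probabilities given by a density *)

(** The density [rho] agrees almost everywhere with the Radon-Nikodym derivative of [L], so the
    integral formula is the change of variables for the latter. It is what makes a coupling out of
    an explicit density on a product space. *)
Lemma density_probability d (T : measurableType d) (R : realType)
    (m : probability T R) (rho : T -> R) :
  measurable_fun setT rho -> (forall x, 0 <= rho x) ->
  (\int[m]_x (rho x)%:E = 1)%E ->
  exists L : probability T R,
    (forall A, measurable A -> L A = \int[m]_(x in A) (rho x)%:E)%E /\
    forall c : T -> R, measurable_fun setT c -> (forall x, 0 <= c x) ->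
      (\int[L]_x (c x)%:E = \int[m]_x (c x * rho x)%:E)%E.
Proof.
move=> mrho rho0 rho1.
have mErho : measurable_fun setT (fun x => (rho x)%:E) by exact/measurable_EFinP.
pose lam := (fun A => \int[m]_(x in A) (rho x)%:E)%E.
have lam0 : (lam set0 = 0)%E by rewrite /lam integral_set0.
have lam_ge0 A : (0 <= lam A)%E.
  by apply: integral_ge0 => x _; rewrite lee_fin.
have lam_add : semi_sigma_additive lam.
  by apply: semi_sigma_additive_nng_induced => // x; rewrite lee_fin.
pose mix := isMeasure.Build _ _ _ lam lam0 lam_ge0 lam_add.
pose L0 : {measure set T -> \bar R} := HB.pack lam mix.
pose L : probability T R := HB.pack lam mix (Measure_isProbability.Build _ _ _ L0 rho1).
exists L; split => // c mc c0.
have dom : L `<< m.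
  apply/null_content_dominatesP => A mA mA0.
  by apply: null_set_integral => //; exact/measurable_funTS.
have intrho : m.-integrable setT (fun x => (rho x)%:E).
  apply/integrableP; split => //.
  under eq_integral do rewrite gee0_abs ?lee_fin//.
  by rewrite rho1 ltry.
(* Equal integrals over every measurable set force equality almost everywhere. *)
have rnE : ae_eq m setT (fun x => (rho x)%:E) (Radon_Nikodym_SigmaFinite.f L m).
  apply: integral_ae_eq => //.
    exact: measurable_int (Radon_Nikodym_SigmaFinite.f_integrable dom).
  by move=> E _ mE; rewrite -Radon_Nikodym_SigmaFinite.f_integral.
rewrite -(Radon_Nikodym_SigmaFinite.change_of_variables dom) //; last first.
  exact/measurable_EFinP.
apply: ge0_ae_eq_integral => //.
- apply: emeasurable_funM; first exact/measurable_EFinP.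
  exact: measurable_int (Radon_Nikodym_SigmaFinite.f_integrable dom).
- by apply/measurable_EFinP/measurable_funM.
- move=> x _; apply: mule_ge0; rewrite ?lee_fin//.
  exact: Radon_Nikodym_SigmaFinite.f_ge0.
- by move=> x _; rewrite lee_fin mulr_ge0.
- by apply: filterS rnE => x /= /(_ I) <- _; rewrite EFinM.
Qed.

(** * Integrals of nonnegative functions *)

(** Under these two conditions integrals are additive and monotone with the value [+oo] allowed, so
    costs can be compared before anything is known to be integrable. *)
Definition nnmeas {R : realType} {d} {T : measurableType d} (f : T -> R) :=
  measurable_fun setT f /\ forall x, 0 <= f x.

Lemma nnmeasD (R : realType) d (T : measurableType d) (f g : T -> R) :
  nnmeas f -> nnmeas g -> nnmeas (fun x => f x + g x).
Proof.
by move=> [mf f0] [mg g0]; split=> [|x]; [exact: measurable_funD|exact: addr_ge0].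
Qed.

Lemma nnmeasM (R : realType) d (T : measurableType d) (f g : T -> R) :
  nnmeas f -> nnmeas g -> nnmeas (fun x => f x * g x).
Proof.
by move=> [mf f0] [mg g0]; split=> [|x]; [exact: measurable_funM|exact: mulr_ge0].
Qed.

Lemma nnmeas_cst (R : realType) d (T : measurableType d) (k : R) :
  0 <= k -> nnmeas (fun _ : T => k).
Proof. by move=> k0; split. Qed.

Lemma nnmeas_sum (R : realType) d (T : measurableType d) (I : Type) (s : seq I)
    (f : I -> T -> R) :
  (forall i, nnmeas (f i)) -> nnmeas (fun x => \sum_(i <- s) f i x).
Proof.
move=> nf; split=> [|x]; last by apply: sumr_ge0 => i _; case: (nf i).
by apply: measurable_sum => i; case: (nf i).
Qed.

Lemma nnmeas_prod (R : realType) d (T : measurableType d) (I : eqType) (s : seq I)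
    (f : I -> T -> R) :
  (forall i, nnmeas (f i)) -> nnmeas (fun x => \prod_(i <- s) f i x).
Proof.
move=> nf; split=> [|x]; last by apply: prodr_ge0 => i _; case: (nf i).
by apply: measurable_prod => i _; have [] := nf i.
Qed.

Lemma nnmeas_comp (R : realType) d (T : measurableType d) d' (U : measurableType d')
    (f : U -> R) (X : T -> U) :
  measurable_fun setT X -> nnmeas f -> nnmeas (fun x => f (X x)).
Proof. by move=> mX [mf f0]; split=> // ; exact: measurableT_comp. Qed.

Lemma nnmeas_norm (R : realType) d (T : measurableType d) (f : T -> R) :
  measurable_fun setT f -> nnmeas (fun x => `|f x|).
Proof. by move=> mf; split=> //; exact: measurableT_comp. Qed.

Lemma nnmeas_indic (R : realType) d (T : measurableType d) (A : set T) :
  measurable A -> nnmeas (\1_A : T -> R).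
Proof. by move=> mA; split. Qed.

Lemma nnmeas_meas (R : realType) d (T : measurableType d) (f : T -> R) :
  nnmeas f -> measurable_fun setT (fun x => (f x)%:E).
Proof. by move=> [mf _]; exact/measurable_EFinP. Qed.

Lemma nnmeas_ge0 (R : realType) d (T : measurableType d) (f : T -> R) x :
  nnmeas f -> (0 <= (f x)%:E)%E.
Proof. by move=> [_ f0]; rewrite lee_fin. Qed.
#[local] Hint Resolve nnmeas_meas nnmeas_ge0 : core.

Lemma nnintD (R : realType) d (T : measurableType d) (m : {measure set T -> \bar R})
    (f g : T -> R) : nnmeas f -> nnmeas g ->
  (\int[m]_x (f x + g x)%:E = \int[m]_x (f x)%:E + \int[m]_x (g x)%:E)%E.
Proof. by move=> nf ng; rewrite -ge0_integralD//; auto. Qed.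

Lemma nnintZ (R : realType) d (T : measurableType d) (m : {measure set T -> \bar R})
    (f : T -> R) (k : R) : nnmeas f -> 0 <= k ->
  (\int[m]_x (k * f x)%:E = k%:E * \int[m]_x (f x)%:E)%E.
Proof. by move=> nf k0; rewrite -ge0_integralZl//; auto. Qed.

Lemma nnint_sum (R : realType) d (T : measurableType d) (m : {measure set T -> \bar R})
    (I : Type) (s : seq I) (f : I -> T -> R) : (forall i, nnmeas (f i)) ->
  (\int[m]_x (\sum_(i <- s) f i x)%:E = \sum_(i <- s) \int[m]_x (f i x)%:E)%E.
Proof.
move=> nf; rewrite -ge0_integral_sum//; [|by auto..].
by apply: eq_integral => x _; rewrite sumEFin.
Qed.

Lemma nnint_le (R : realType) d (T : measurableType d) (m : {measure set T -> \bar R})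
    (f g : T -> R) : nnmeas f -> nnmeas g -> (forall x, f x <= g x) ->
  (\int[m]_x (f x)%:E <= \int[m]_x (g x)%:E)%E.
Proof.
by move=> nf ng fg; apply: ge0_le_integral => //; [auto..|move=> x _; rewrite lee_fin].
Qed.

Lemma nnint_ge0 (R : realType) d (T : measurableType d) (m : {measure set T -> \bar R})
    (f : T -> R) : nnmeas f -> (0 <= \int[m]_x (f x)%:E)%E.
Proof. by move=> nf; apply: integral_ge0 => x _; auto. Qed.

Lemma nnint_cst (R : realType) d (T : measurableType d) (P : probability T R) (k : R) :
  (\int[P]_x k%:E = k%:E)%E.
Proof.
by have := integral_cst P measurableT k%:E; rewrite /= probability_setT mule1.
Qed.

Lemma nnmeas_tensor (R : realType) d1 (T1 : measurableType d1) d2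
    (T2 : measurableType d2) (f : T1 -> R) (g : T2 -> R) :
  nnmeas f -> nnmeas g -> nnmeas (fun z : T1 * T2 => f z.1 * g z.2).
Proof.
move=> nf ng; apply: nnmeasM.
- by apply: (@nnmeas_comp R _ (T1 * T2)%type _ T1 f fst).
- by apply: (@nnmeas_comp R _ (T1 * T2)%type _ T2 g snd).
Qed.

Lemma nnint_prod (R : realType) d1 (T1 : measurableType d1) d2 (T2 : measurableType d2)
    (P1 : probability T1 R) (P2 : probability T2 R) (f : T1 -> R) (g : T2 -> R) :
  nnmeas f -> nnmeas g ->
  (\int[P1 \x P2]_z (f z.1 * g z.2)%:E = \int[P1]_x (f x)%:E * \int[P2]_y (g y)%:E)%E.
Proof.
move=> nf ng; have nfg := @nnmeas_tensor R _ T1 _ T2 f g nf ng.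
rewrite (fubini_tonelli1 (fun z => (f z.1 * g z.2)%:E))/=;
  [|exact: (nnmeas_meas nfg)|by move=> z; exact: (nnmeas_ge0 z nfg)].
rewrite -ge0_integralZr//; [|by auto..|exact: nnint_ge0].
apply: eq_integral => x _; rewrite /fubini_F/= nnintZ//; first by case: nf.
Qed.

Lemma image_probability (R : realType) d (T : measurableType d) d' (U : measurableType d')
    (P : probability T R) (X : T -> U) : measurable_fun setT X ->
  exists Q : probability U R, (forall A, Q A = P (X @^-1` A)) /\
    forall c : U -> R, nnmeas c -> (\int[Q]_x (c x)%:E = \int[P]_x (c (X x))%:E)%E.
Proof.
move=> mX; pose X' : {RV P >-> U} := HB.pack X (isMeasurableFun.Build _ _ _ _ _ mX).
exists (distribution P X'); split=> // c nc.
by rewrite ge0_integral_distribution//; auto.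
Qed.

(** Both integrals equal the one against the common law on [U]. Two source spaces are allowed
    because the lemma mostly compares a coupling on a product space with one of its marginals. *)
Lemma nnint_same_law (R : realType) d1 (T1 : measurableType d1) d2
    (T2 : measurableType d2) d (U : measurableType d) (P1 : {measure set T1 -> \bar R})
    (P2 : {measure set T2 -> \bar R}) (X1 : T1 -> U) (X2 : T2 -> U) (c : U -> R) :
  measurable_fun setT X1 -> measurable_fun setT X2 ->
  (forall A, measurable A -> P1 (X1 @^-1` A) = P2 (X2 @^-1` A)) -> nnmeas c ->
  (\int[P1]_x (c (X1 x))%:E = \int[P2]_x (c (X2 x))%:E)%E.
Proof.
move=> mX1 mX2 same nc.
have := @ge0_integral_pushforward _ _ _ _ R X1 mX1 P1 setT
  (fun x => (c x)%:E) measurableT.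
have := @ge0_integral_pushforward _ _ _ _ R X2 mX2 P2 setT
  (fun x => (c x)%:E) measurableT.
have c0 : {in [set: U], forall y, (0 <= (c y)%:E)%E} by move=> y _; auto.
rewrite !preimage_setT => /(_ (nnmeas_meas nc) c0) e2 /(_ (nnmeas_meas nc) c0) e1.
rewrite -e1 -e2; apply: eq_measure_integral => A mA _; exact: same.
Qed.

(** * Coupling along a partition of unity *)

Lemma nnint_fin (R : realType) d (T : measurableType d) (P : probability T R)
    (f : T -> R) : nnmeas f -> (forall x, f x <= 1) ->
  (\int[P]_x (f x)%:E = (fine (\int[P]_x (f x)%:E))%:E)%E.
Proof.
move=> nf f1; rewrite fineK// ge0_fin_numE ?nnint_ge0//.
apply: (@le_lt_trans _ _ 1%E); last exact: ltry.
by rewrite -(nnint_cst P 1); apply: nnint_le => //; exact: nnmeas_cst.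
Qed.

(* With [a = mu / p] this is a marginal of the coupling density below; the
   factor [r^-1 * r] is [0] when [r = 0], and then [alpha] vanishes a.e. *)
Lemma partition_marginal (R : realType) d (T : measurableType d) (P : probability T R)
    (J : finType) (phi : J -> T -> R) (a : J -> R) (r : R) (f : T -> R) :
  (forall j, nnmeas (phi j)) -> (forall w, \sum_j phi j w = 1) ->
  (forall j, 0 <= a j <= 1) ->
  (\int[P]_w (\sum_j (1 - a j) * phi j w)%:E = r%:E)%E ->
  nnmeas f -> (forall w, f w <= 1) ->
  (\sum_j (a j)%:E * \int[P]_w (f w * phi j w)%:E +
   (r^-1 * r)%:E * \int[P]_w (f w * \sum_j (1 - a j) * phi j w)%:E =
   \int[P]_w (f w)%:E)%E.
Proof.
move=> nphi phi1 a01 intal nf f1.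
have a0 j : 0 <= a j by have /andP[] := a01 j.
have a1 j : 0 <= 1 - a j by have /andP[_] := a01 j; rewrite subr_ge0.
have nal : nnmeas (fun w => \sum_j (1 - a j) * phi j w).
  by apply: nnmeas_sum => j; apply: nnmeasM => //; exact: nnmeas_cst.
have -> : ((r^-1 * r)%:E * \int[P]_w (f w * \sum_j (1 - a j) * phi j w)%:E =
    \int[P]_w (f w * \sum_j (1 - a j) * phi j w)%:E)%E.
  have [r0|r0] := eqVneq r 0; last by (rewrite mulVf; [rewrite mul1e|]).
  rewrite r0 mulr0 mul0e; apply/esym/eqP.
  rewrite eq_le nnint_ge0 ?andbT; last exact: (nnmeasM nf nal).
  have -> : 0%E = (\int[P]_w (\sum_j (1 - a j) * phi j w)%:E)%E by rewrite intal r0.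
  apply: nnint_le => [||w]; [exact: (nnmeasM nf nal)|exact: nal|].
  by rewrite ler_piMl//; case: nal.
under eq_bigr => j _ do rewrite -(nnintZ P (nnmeasM nf (nphi j)) (a0 j)).
rewrite -nnint_sum; last by move=> j; apply: nnmeasM; [exact: nnmeas_cst|exact: nnmeasM].
rewrite -nnintD; first last.
- exact: nnmeasM.
- by apply: nnmeas_sum => j; apply: nnmeasM; [exact: nnmeas_cst|exact: nnmeasM].
apply: eq_integral => w _; congr (_%:E); rewrite mulr_sumr -big_split/=.
transitivity (f w * \sum_j phi j w); last by rewrite phi1 mulr1.
rewrite mulr_sumr; apply: eq_bigr => j _; ring.
Qed.

(** In cell [j] the mass min(p j, q j) is common to both sides and is coupled independently within
    the cell, where [a j + b j] bounds the cost. The leftover masses on the two sides are equal;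
    they are coupled independently as well, at a cost bounded by [M + t1 + t2]. The factor of [M] is
    the leftover mass, which is small when the cell masses nearly agree. *)
Lemma partition_coupling (R : realType) d1 (T1 : measurableType d1) d2
    (T2 : measurableType d2) (P1 : probability T1 R) (P2 : probability T2 R)
    (J : finType) (phi : J -> T1 -> R) (psi : J -> T2 -> R) :
  (forall j, nnmeas (phi j)) -> (forall w, \sum_j phi j w = 1) ->
  (forall j, nnmeas (psi j)) -> (forall w, \sum_j psi j w = 1) ->
  exists L : probability (T1 * T2)%type R,
  [/\ forall A, measurable A -> L (fst @^-1` A) = P1 A,
      forall A, measurable A -> L (snd @^-1` A) = P2 A &
      forall (c : T1 * T2 -> R) (a : J -> T1 -> R) (b : J -> T2 -> R) (M : R)
        (t1 : T1 -> R) (t2 : T2 -> R),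
        nnmeas c -> (forall j, nnmeas (a j)) -> (forall j, nnmeas (b j)) ->
        0 <= M -> nnmeas t1 -> nnmeas t2 ->
        (forall j z, c z <= a j z.1 + b j z.2) ->
        (forall z, c z <= M + (t1 z.1 + t2 z.2)) ->
        (\int[L]_z (c z)%:E <=
          \int[P1]_w (\sum_j a j w * phi j w)%:E +
          \int[P2]_w (\sum_j b j w * psi j w)%:E +
          (M * (1 - \sum_j Num.min (fine (\int[P1]_w (phi j w)%:E))
                                   (fine (\int[P2]_w (psi j w)%:E))))%:E +
          (\int[P1]_w (t1 w)%:E + \int[P2]_w (t2 w)%:E))%E].
Proof.
move=> nphi phi1 npsi psi1.
set p := fun j => fine (\int[P1]_w (phi j w)%:E)%E.
set q := fun j => fine (\int[P2]_w (psi j w)%:E)%E.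
have phi_le1 j w : phi j w <= 1.
  by rewrite -(phi1 w) (bigD1 j)//= lerDl sumr_ge0// => i _; case: (nphi i).
have psi_le1 j w : psi j w <= 1.
  by rewrite -(psi1 w) (bigD1 j)//= lerDl sumr_ge0// => i _; case: (npsi i).
have pE j : (\int[P1]_w (phi j w)%:E = (p j)%:E)%E by exact: nnint_fin.
have qE j : (\int[P2]_w (psi j w)%:E = (q j)%:E)%E by exact: nnint_fin.
have p0 j : 0 <= p j by rewrite -lee_fin -pE nnint_ge0.
have q0 j : 0 <= q j by rewrite -lee_fin -qE nnint_ge0.
pose mu j := Num.min (p j) (q j).
have mu0 j : 0 <= mu j by rewrite le_min p0 q0.
have mup j : mu j <= p j by rewrite ge_min lexx.
have muq j : mu j <= q j by rewrite ge_min lexx orbT.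
set r := 1 - _.
have sp : \sum_j p j = 1.
  apply: EFin_inj; rewrite -sumEFin; under eq_bigr do rewrite -pE.
  by rewrite -nnint_sum//; under eq_integral do rewrite phi1; rewrite nnint_cst.
have sq : \sum_j q j = 1.
  apply: EFin_inj; rewrite -sumEFin; under eq_bigr do rewrite -qE.
  by rewrite -nnint_sum//; under eq_integral do rewrite psi1; rewrite nnint_cst.
have r0 : 0 <= r by rewrite subr_ge0 -sp ler_sum// => j _; exact: mup.
(* [ca j] and [cb j] are the fractions of the two masses of cell [j] that get matched; [k j] scales
   the product of [phi j] and [psi j] to total mass [mu j]. *)
pose ca j := mu j / p j; pose cb j := mu j / q j; pose k j := mu j / (p j * q j).
have div01 (x y : R) : 0 <= x -> x <= y -> 0 <= x / y <= 1.
  move=> x0 xy; have y0 := le_trans x0 xy; rewrite divr_ge0//=.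
  have [->|y_neq0] := eqVneq y 0; rewrite ?invr0 ?mulr0//.
  by rewrite ler_pdivrMr ?mul1r// lt0r y_neq0.
have divK (x y : R) : 0 <= x -> x <= y -> x / y * y = x :> R.
  move=> x0 xy; have [y0|y0] := eqVneq y 0; last by rewrite divfK.
  by rewrite y0 mulr0; apply/eqP; rewrite eq_le x0 -y0.
have divMK (x y z : R) : 0 <= x -> x <= y -> x / (z * y) * y = x / z :> R.
  move=> x0 xy; have [y0|y0] := eqVneq y 0; last by rewrite invfM mulrA divfK.
  have -> : x = 0 by apply/eqP; rewrite eq_le x0 andbT -y0.
  by rewrite !mul0r.
have ca01 j : 0 <= ca j <= 1 by exact: div01.
have cb01 j : 0 <= cb j <= 1 by exact: div01.
have k0 j : 0 <= k j by rewrite divr_ge0// mulr_ge0.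
have kq j : k j * q j = ca j.
  by rewrite /k /ca divMK.
have kp j : k j * p j = cb j.
  by rewrite /k /cb mulrC [p j * _]mulrC mulrC divMK.
pose al w := \sum_j (1 - ca j) * phi j w.
pose be w := \sum_j (1 - cb j) * psi j w.
have nal : nnmeas al.
  apply: nnmeas_sum => j; apply: nnmeasM => //; apply: nnmeas_cst.
  by rewrite subr_ge0; have /andP[] := ca01 j.
have nbe : nnmeas be.
  apply: nnmeas_sum => j; apply: nnmeasM => //; apply: nnmeas_cst.
  by rewrite subr_ge0; have /andP[] := cb01 j.
have inal : (\int[P1]_w (al w)%:E = r%:E)%E.
  rewrite nnint_sum; last first.
    move=> j; apply: nnmeasM => //; apply: nnmeas_cst.
    by rewrite subr_ge0; have /andP[] := ca01 j.
  under eq_bigr => j _.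
    rewrite nnintZ//; last by rewrite subr_ge0; have /andP[] := ca01 j.
    rewrite pE -EFinM mulrBl mul1r divK//; over.
  by rewrite sumEFin sumrB sp.
have inbe : (\int[P2]_w (be w)%:E = r%:E)%E.
  rewrite nnint_sum; last first.
    move=> j; apply: nnmeasM => //; apply: nnmeas_cst.
    by rewrite subr_ge0; have /andP[] := cb01 j.
  under eq_bigr => j _.
    rewrite nnintZ//; last by rewrite subr_ge0; have /andP[] := cb01 j.
    rewrite qE -EFinM mulrBl mul1r divK//; over.
  by rewrite sumEFin sumrB sq.
have ri0 : 0 <= r^-1 by rewrite invr_ge0.
(* Cells with [p j = 0] or [q j = 0] need no separate treatment: there
   [mu j = 0], and [x / 0 = 0].  The same holds for [r = 0]. *)
pose rho (z : T1 * T2) := \sum_j k j * (phi j z.1 * psi j z.2) + r^-1 * (al z.1 * be z.2).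
have nkpp j : nnmeas (fun z : T1 * T2 => k j * (phi j z.1 * psi j z.2)).
  by apply: nnmeasM; [exact: nnmeas_cst|exact: nnmeas_tensor].
have nrab : nnmeas (fun z : T1 * T2 => r^-1 * (al z.1 * be z.2)).
  by apply: nnmeasM; [exact: nnmeas_cst|exact: nnmeas_tensor].
have nrho : nnmeas rho by apply: nnmeasD => //; exact: nnmeas_sum.
have tensor_int (f : T1 -> R) (g : T2 -> R) : nnmeas f -> nnmeas g ->
    (\int[P1 \x P2]_z (f z.1 * g z.2 * rho z)%:E =
     \sum_j (k j)%:E * (\int[P1]_w (f w * phi j w)%:E * \int[P2]_w (g w * psi j w)%:E) +
     (r^-1)%:E * (\int[P1]_w (f w * al w)%:E * \int[P2]_w (g w * be w)%:E))%E.
  move=> nf ng.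
  have nfp j : nnmeas (fun w => f w * phi j w) by exact: nnmeasM.
  have ngp j : nnmeas (fun w => g w * psi j w) by exact: nnmeasM.
  have nfa : nnmeas (fun w => f w * al w) by exact: nnmeasM.
  have ngb : nnmeas (fun w => g w * be w) by exact: nnmeasM.
  have nt1 j := nnmeas_tensor (nfp j) (ngp j).
  have nt2 := nnmeas_tensor nfa ngb.
  have n1 j : nnmeas (fun z : T1 * T2 =>
      k j * ((f z.1 * phi j z.1) * (g z.2 * psi j z.2))).
    by apply: nnmeasM => //; exact: nnmeas_cst.
  have n2 : nnmeas (fun z : T1 * T2 => r^-1 * ((f z.1 * al z.1) * (g z.2 * be z.2))).
    by apply: nnmeasM => //; exact: nnmeas_cst.
  under eq_integral => z _.
    have -> : f z.1 * g z.2 * rho z =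
        \sum_j k j * ((f z.1 * phi j z.1) * (g z.2 * psi j z.2)) +
        r^-1 * ((f z.1 * al z.1) * (g z.2 * be z.2)).
      by rewrite /rho mulrDr mulr_sumr; congr (_ + _); [apply: eq_bigr => j _|]; ring.
    over.
  rewrite nnintD//; last exact: nnmeas_sum.
  rewrite nnint_sum//; congr (_ + _)%E.
    by apply: eq_bigr => j _; rewrite nnintZ// (nnint_prod _ _ (nfp j) (ngp j)).
  by rewrite nnintZ// (nnint_prod _ _ nfa ngb).
have n1 d (T : measurableType d) : nnmeas (fun _ : T => 1 : R) by exact: nnmeas_cst.
have marg1 (f : T1 -> R) : nnmeas f -> (forall w, f w <= 1) ->
    (\int[P1 \x P2]_z (f z.1 * rho z)%:E = \int[P1]_w (f w)%:E)%E.
  move=> nf f1; rewrite -(partition_marginal nphi phi1 ca01 inal nf f1).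
  under eq_integral do rewrite -[f _]mulr1.
  rewrite (tensor_int _ (fun=> 1))//; congr (_ + _)%E.
    apply: eq_bigr => j _; under [X in (_ * (_ * X))%E]eq_integral do rewrite mul1r.
    by rewrite qE muleCA -EFinM kq muleC.
  under [X in (_ * (_ * X))%E]eq_integral do rewrite mul1r.
  by rewrite inbe muleCA -EFinM muleC.
have marg2 (f : T2 -> R) : nnmeas f -> (forall w, f w <= 1) ->
    (\int[P1 \x P2]_z (f z.2 * rho z)%:E = \int[P2]_w (f w)%:E)%E.
  move=> nf f1; rewrite -(partition_marginal npsi psi1 cb01 inbe nf f1).
  under eq_integral do rewrite -[f _]mul1r.
  rewrite (tensor_int (fun=> 1))//; congr (_ + _)%E.
    apply: eq_bigr => j _; under [X in (_ * (X * _))%E]eq_integral do rewrite mul1r.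
    by rewrite pE muleA -EFinM kp.
  under [X in (_ * (X * _))%E]eq_integral do rewrite mul1r.
  by rewrite inal muleA -EFinM.
have rho1 : (\int[P1 \x P2]_z (rho z)%:E = 1)%E.
  have := marg1 (fun=> 1) (n1 _ _) (fun=> lexx _).
  by under eq_integral do rewrite mul1r; rewrite nnint_cst.
have [L [_ Lc]] := @density_probability _ _ R (P1 \x P2 : probability (T1 * T2)%type R)%E
  rho nrho.1 nrho.2 rho1.
exists L; split.
- move=> A mA; have mA' : measurable (fst @^-1` A : set (T1 * T2)).
    by rewrite -[X in measurable X]setTI; exact: measurable_fst.
  have := Lc (\1_(fst @^-1` A)) (nnmeas_indic R mA').1 (nnmeas_indic R mA').2.
  rewrite integral_indic// setIT => ->.
  rewrite (_ : P1 A = \int[P1]_w (\1_A w)%:E)%E; last by rewrite integral_indic// setIT.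
  by rewrite -(marg1 _ (nnmeas_indic R mA))// => w; rewrite indicE; case: (_ \in _).
- move=> A mA; have mA' : measurable (snd @^-1` A : set (T1 * T2)).
    by rewrite -[X in measurable X]setTI; exact: measurable_snd.
  have := Lc (\1_(snd @^-1` A)) (nnmeas_indic R mA').1 (nnmeas_indic R mA').2.
  rewrite integral_indic// setIT => ->.
  rewrite (_ : P2 A = \int[P2]_w (\1_A w)%:E)%E; last by rewrite integral_indic// setIT.
  by rewrite -(marg2 _ (nnmeas_indic R mA))// => w; rewrite indicE; case: (_ \in _).
move=> c a b M t1 t2 nc na nb M0 nt1 nt2 cab cMt.
rewrite Lc; [|by case: nc..].
have naf j : nnmeas (fun w => a j w * phi j w) by exact: nnmeasM.
have nbg j : nnmeas (fun w => b j w * psi j w) by exact: nnmeasM.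
have nta : nnmeas (fun w => t1 w * al w) by exact: nnmeasM.
have ntb : nnmeas (fun w => t2 w * be w) by exact: nnmeasM.
(* The cost bound times the density is a sum of pure tensors, so each integral factorizes. The
   factor free of [a], [b], [t1], [t2] integrates to [p j], [q j] or [r], and together with [k j] or
   [r^-1] it gives a constant at most 1. *)
pose E1 j (z : T1 * T2) := k j * ((a j z.1 * phi j z.1) * psi j z.2).
pose E2 j (z : T1 * T2) := k j * (phi j z.1 * (b j z.2 * psi j z.2)).
pose F0 (z : T1 * T2) := (r^-1 * M) * (al z.1 * be z.2).
pose F1 (z : T1 * T2) := r^-1 * ((t1 z.1 * al z.1) * be z.2).
pose F2 (z : T1 * T2) := r^-1 * (al z.1 * (t2 z.2 * be z.2)).
have nt1' j := nnmeas_tensor (naf j) (npsi j).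
have nt2' j := nnmeas_tensor (nphi j) (nbg j).
have nt3' := nnmeas_tensor nal nbe.
have nt4' := nnmeas_tensor nta nbe.
have nt5' := nnmeas_tensor nal ntb.
have nE1 j : nnmeas (E1 j) by apply: nnmeasM => //; exact: nnmeas_cst.
have nE2 j : nnmeas (E2 j) by apply: nnmeasM => //; exact: nnmeas_cst.
have nF0 : nnmeas F0 by apply: nnmeasM => //; apply: nnmeas_cst; exact: mulr_ge0.
have nF1 : nnmeas F1 by apply: nnmeasM => //; exact: nnmeas_cst.
have nF2 : nnmeas F2 by apply: nnmeasM => //; exact: nnmeas_cst.
have nE j : nnmeas (fun z => E1 j z + E2 j z) by exact: nnmeasD.
have nsE : nnmeas (fun z => \sum_j (E1 j z + E2 j z)) by exact: nnmeas_sum.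
have nF12 : nnmeas (fun z => F1 z + F2 z) by exact: nnmeasD.
have nF : nnmeas (fun z => F0 z + (F1 z + F2 z)) by exact: nnmeasD.
apply: (@le_trans _ _ (\int[P1 \x P2]_z
    (\sum_j (E1 j z + E2 j z) + (F0 z + (F1 z + F2 z)))%:E)%E).
  apply: nnint_le => [||z]; [exact: nnmeasM|exact: nnmeasD|].
  rewrite /rho mulrDr mulr_sumr; apply: lerD.
    apply: ler_sum => j _.
    have -> : E1 j z + E2 j z = (a j z.1 + b j z.2) * (k j * (phi j z.1 * psi j z.2)).
      by rewrite /E1 /E2; move: (k j) => kj; ring.
    by apply: ler_wpM2r; [case: (nkpp j)|exact: cab].
  have -> : F0 z + (F1 z + F2 z) = (M + (t1 z.1 + t2 z.2)) * (r^-1 * (al z.1 * be z.2)).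
    by rewrite /F0 /F1 /F2; move: (r^-1) => ri; ring.
  by apply: ler_wpM2r; [case: nrab|exact: cMt].
have kq1 j : k j * q j <= 1 by rewrite kq; have /andP[] := ca01 j.
have kp1 j : k j * p j <= 1 by rewrite kp; have /andP[] := cb01 j.
have rr1 : r^-1 * r <= 1.
  by have [->|r_neq0] := eqVneq r 0; rewrite ?mulr0// mulVf.
have le1 (x : R) (y : \bar R) : x <= 1 -> (0 <= y -> x%:E * y <= y)%E.
  by move=> x1 y0; rewrite -[leRHS]mul1e; apply: lee_wpmul2r => //; rewrite lee_fin.
rewrite nnintD// nnint_sum// -addeA; apply: leeD.
  rewrite nnint_sum// [X in (_ + X)%E]nnint_sum// -big_split/=; apply: lee_sum => j _.
  rewrite nnintD//; apply: leeD.
    rewrite nnintZ// (nnint_prod _ _ (naf j) (npsi j)) qE.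
    by rewrite muleCA muleC -EFinM; apply: le1 => //; exact: nnint_ge0.
  rewrite nnintZ// (nnint_prod _ _ (nphi j) (nbg j)) pE.
  by rewrite muleA -EFinM; apply: le1 => //; exact: nnint_ge0.
rewrite nnintD// nnintD//; apply: leeD; last apply: leeD.
- rewrite nnintZ ?mulr_ge0// (nnint_prod _ _ nal nbe) inal inbe -!EFinM lee_fin.
  rewrite mulrACA.
  by rewrite ler_piMl// mulr_ge0.
- rewrite nnintZ// (nnint_prod _ _ nta nbe) inbe muleCA muleC -EFinM.
  apply: (@le_trans _ _ (\int[P1]_w (t1 w * al w)%:E)%E).
    by apply: le1 => //; exact: nnint_ge0.
  (* The leftover density [al] is at most 1, its coefficients [1 - ca j] being so. *)
  apply: nnint_le => // w; rewrite ler_piMr//; first by case: nt1.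
  rewrite -(phi1 w); apply: ler_sum => j _; rewrite ler_piMl//; first by case: (nphi j).
  by rewrite gerBl; have /andP[] := ca01 j.
- rewrite nnintZ// (nnint_prod _ _ nal ntb) inal muleA -EFinM.
  apply: (@le_trans _ _ (\int[P2]_w (t2 w * be w)%:E)%E).
    by apply: le1 => //; exact: nnint_ge0.
  apply: nnint_le => // w; rewrite ler_piMr//; first by case: nt2.
  rewrite -(psi1 w); apply: ler_sum => j _; rewrite ler_piMl//; first by case: (npsi j).
  by rewrite gerBl; have /andP[] := cb01 j.
Qed.

(** * Bernstein weights of a sine *)

(* Probability that [k] of [n] independent trials succeed, each with
   probability [y]; in recursive form, so that it is visibly built from [y] by
   sums and products. *)
Fixpoint bern {R : pzRingType} (n k : nat) (y : R) : R :=
  if n is n'.+1 then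
    (1 - y) * bern n' k y + (if k is k'.+1 then y * bern n' k' y else 0)
  else (k == 0%N)%:R.

Lemma bern_ge0 (R : realType) n k (y : R) : 0 <= y <= 1 -> 0 <= bern n k y.
Proof.
move=> /andP[y0 y1]; elim: n k => [|n IHn] k /=; first by rewrite ler0n.
by apply: addr_ge0; [|case: k => // k]; apply: mulr_ge0 => //; rewrite subr_ge0.
Qed.

Lemma bern_gt (R : pzRingType) n k (y : R) : (n < k)%N -> bern n k y = 0.
Proof.
elim: n k => [|n IHn] [|k]//= nk.
by rewrite IHn ?(ltn_trans _ nk)// IHn// !mulr0 addr0.
Qed.

(** Conditioning on one trial: a failure leaves the count alone, a success raises it by one. *)
Lemma bern_mean_rec (R : pzRingType) n (y : R) (h : nat -> R) :
  \sum_(k < n.+2) bern n.+1 k y * h k =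
  (1 - y) * \sum_(k < n.+1) bern n k y * h k +
  y * \sum_(k < n.+1) bern n k y * h k.+1.
Proof.
under eq_bigr do rewrite /= mulrDl; rewrite big_split/=; congr (_ + _).
  rewrite big_ord_recr/= bern_gt// mulr0 mul0r addr0 mulr_sumr.
  by apply: eq_bigr => k _; rewrite mulrA.
rewrite big_ord_recl/= mul0r add0r mulr_sumr.
by apply: eq_bigr => k _; rewrite mulrA.
Qed.

Lemma bern_sum (R : pzRingType) n (y : R) : \sum_(k < n.+1) bern n k y = 1.
Proof.
under eq_bigr do rewrite -[bern _ _ _]mulr1.
elim: n => [|n IHn]; first by rewrite big_ord1 mulr1.
by rewrite (bern_mean_rec n y (fun=> 1)) IHn !mulr1 subrK.
Qed.

(** Variance plus squared bias. The centre [c] is arbitrary because a success replaces it by [c - 1]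
    in the induction. *)
Lemma bern_variance (R : comPzRingType) n (y c : R) :
  \sum_(k < n.+1) bern n k y * (k%:R - c) ^+ 2 =
  n%:R * (y * (1 - y)) + (n%:R * y - c) ^+ 2.
Proof.
elim: n c => [|n IHn] c; first by rewrite big_ord1 /=; ring.
rewrite (bern_mean_rec n y (fun k => (k%:R - c) ^+ 2)) IHn.
have -> : \sum_(k < n.+1) bern n k y * (k.+1%:R - c) ^+ 2 =
    \sum_(k < n.+1) bern n k y * (k%:R - (c - 1)) ^+ 2.
  by apply: eq_bigr => k _; congr (_ * _ ^+ 2); rewrite -natr1; ring.
by rewrite IHn -natr1; ring.
Qed.

(** By the mean value theorem the slope is cos c with |c| <= 1, hence at least cos 1 > 0. Closeness
    of sines can thus be turned back into closeness of their arguments. *)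
Lemma sin_expansive (R : realType) (u v : R) : `|u| <= 1 -> `|v| <= 1 ->
  cos 1 * `|u - v| <= `|sin u - sin v|.
Proof.
wlog uv : u v / v <= u.
  move=> H u1 v1; have [vu|uv] := leP v u; first exact: H.
  by rewrite distrC [leRHS]distrC; apply: H => //; exact: ltW.
move=> u1 v1.
have [c cI ->] := @MVT_segment R sin cos v u uv (fun x _ => is_derive_sin x)
  (continuous_subspaceT (@continuous_sin R)).
rewrite normrM ler_wpM2r//.
have c1 : `|c| <= 1.
  move: cI u1 v1; rewrite in_itv/= !ler_norml.
  by move=> /andP[? ?] /andP[? ?] /andP[? ?]; apply/andP; split; lra.
apply: le_trans (ler_norm _); rewrite -(cos_norm c).
have pi2 := pi_ge2 R.
rewrite leNgt ltr_cos ?in_itv/= -?leNgt//; apply/andP; split=> //; lra.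
Qed.

(* [z] is an arcsine of the projection of [s] onto [[- sin 1, sin 1]]. *)
Lemma sin_clamp (R : realType) (s : R) : exists z, `|z| <= 1 /\
  forall u, `|u| <= 1 -> cos 1 * `|u - z| <= `|sin u - s|.
Proof.
have sin_in (u : R) : `|u| <= 1 -> - sin 1 <= sin u <= sin 1.
  move=> u1.
  have mono (a b : R) : -1 <= a -> b <= 1 -> a <= b -> sin a <= sin b.
    move=> a1 b1 ab.
    have [c cI e] := @MVT_segment R sin cos a b ab (fun x _ => is_derive_sin x)
      (continuous_subspaceT (@continuous_sin R)).
    rewrite -subr_ge0 e mulr_ge0 ?subr_ge0//; apply: cos_ge0_pihalf.
    have := pihalf_ge1 R; move: cI; rewrite in_itv/= => /andP[? ?] ?.
    by apply/andP; split; lra.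
  move: u1; rewrite ler_norml => /andP[u1 u2]; rewrite -sinN !mono//; lra.
have sin1_ge0 : 0 <= sin 1 :> R.
  have := sin_in 0; rewrite normr0 sin0 => /(_ ler01) /andP[] //.
pose cl := Num.max (- sin 1) (Num.min (sin 1) s).
have cl_in : - sin 1 <= cl <= sin 1.
  by rewrite /cl le_max lexx/= ge_max ge_min lexx/= andbT; lra.
have [||z zI sinz] := @IVT R sin (-1) 1 cl _ (continuous_subspaceT (@continuous_sin R)).
- lra.
- by rewrite sinN min_l ?max_r//; lra.
have z1 : `|z| <= 1 by move: zI; rewrite in_itv/= ler_norml.
exists z; split=> // u u1; apply: le_trans (sin_expansive u1 z1) _.
(* [sin u] lies in the interval onto which [s] is projected, and the projection is no farther from
   it than [s]. *)
rewrite sinz; have /andP[? ?] := sin_in u u1.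
rewrite /cl; case: (leP (sin 1) s) => ?; case: (leP (- sin 1)) => ?//.
- by rewrite !ler0_norm; lra.
- by rewrite !ler0_norm; lra.
- by rewrite !ger0_norm; lra.
Qed.

(** The sum is the mean distance from [u] to the node [z k] when [k] is binomial with success
    probability (1 + sin u) / 2. *)
Definition localized {R : realType} (n : nat) (z : 'I_n.+1 -> R) (delta : R) :=
  forall u, `|u| <= 1 ->
    \sum_(k < n.+1) bern n k ((1 + sin u) / 2) * `|u - z k| <= delta.

(** This is the law of large numbers in Bernstein's form: the frequency [k / n] concentrates at (1 +
    sin u) / 2, at a rate uniform in [u], and [sin_clamp] carries the estimate from sines back to
    points. *)
Lemma bern_sin_localized (R : realType) (delta : R) : 0 < delta ->
  exists (n : nat) (z : 'I_n.+1 -> R), (forall k, `|z k| <= 1) /\ localized z delta.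
Proof.
move=> delta0; have c0 := cos1_gt0 R.
(* The bound below is 2 eta plus 2 y (1 - y) / (eta n), and n >= eta^-2 makes the second term at
   most 2 eta. The total 4 eta must equal cos 1 * delta. *)
pose eta := cos 1 * delta / 4.
have eta0 : 0 < eta by rewrite divr_gt0// mulr_gt0.
pose n := (Num.truncn (eta ^+ 2)^-1).+1.
have nE : (eta ^+ 2)^-1 <= n%:R by apply: ltW; exact: truncnS_gt.
have n0 : 0 < n%:R :> R by rewrite ltr0n.
(* A frequency k / n stands for a sine equal to 2 k / n - 1. *)
have [z hz] := choice (fun k : 'I_n.+1 => @sin_clamp R (2 * (k%:R / n%:R) - 1)).
exists n, z; split=> [k|u u1]; first by case: (hz k).
set y := (1 + sin u) / 2.
have y01 : 0 <= y <= 1.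
  by have := sin_geN1 u; have := sin_le1 u; rewrite /y => ? ?; apply/andP; split; lra.
have b0 k := bern_ge0 n k y01.
rewrite -(ler_pM2l c0) mulr_sumr.
have bnd (k : 'I_n.+1) : cos 1 * (bern n k y * `|u - z k|) <=
    bern n k y * (2 * eta) +
    bern n k y * (k%:R - n%:R * y) ^+ 2 * (2 / (eta * n%:R ^+ 2)).
  have [_ /(_ u u1) H] := hz k.
  rewrite mulrCA -mulrA -mulrDr ler_wpM2l//; apply: le_trans H _.
  set t := (k%:R - n%:R * y) / n%:R.
  have -> : sin u - (2 * (k%:R / n%:R) - 1) = - (2 * t).
    by rewrite /t /y; field; rewrite gt_eqF.
  have -> : (k%:R - n%:R * y) ^+ 2 * (2 / (eta * n%:R ^+ 2)) = 2 * (t ^+ 2 / eta).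
    by rewrite /t; field; rewrite !gt_eqF.
  rewrite normrN normrM ger0_norm// -mulrDr ler_wpM2l//.
  (* What remains is eta |t| <= eta^2 + t^2, which trades the first moment for the second one. *)
  rewrite -(ler_pM2l eta0) mulrDr (mulrCA eta (t ^+ 2)) divff ?gt_eqF// mulr1.
  rewrite -(real_normK (num_real t)).
  have := sqr_ge0 (eta - `|t|); have := normr_ge0 t; nra.
apply: le_trans (ler_sum _ (fun k _ => bnd k)) _.
rewrite big_split/= -!mulr_suml bern_sum mul1r bern_variance subrr expr0n/= addr0.
have : eta^-1 * n%:R^-1 <= eta.
  rewrite -invfM invf_ple ?posrE ?mulr_gt0//.
  by rewrite -ler_pdivrMl// -invfM -expr2.
have -> : n%:R * (y * (1 - y)) * (2 / (eta * n%:R ^+ 2)) =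
    2 * (y * (1 - y)) * (eta^-1 * n%:R^-1) by field; rewrite !gt_eqF.
have -> : cos 1 * delta = 4 * eta by rewrite /eta; field.
have : 0 <= eta^-1 * n%:R^-1 by rewrite mulr_ge0// invr_ge0 ltW.
have : 0 <= y * (1 - y) <= 1 by move: y01 => /andP[? ?]; apply/andP; split; nra.
move: (eta^-1 * _) (y * _) => a b /andP[? ?] ? ?; nra.
Qed.

(** * A localized partition of unity *)

(** A Lipschitz substitute for the cut-off of |u| at |u| > L: it vanishes up to L / 2 and exceeds L
    / 2 beyond L. *)
Definition tail {R : realType} (L u : R) : R := Num.max (`|u| - L / 2) 0.

Lemma tail_ge0 (R : realType) (L u : R) : 0 <= tail L u.
Proof. by rewrite /tail le_max lexx orbT. Qed.

Lemma norm_le_tail (R : realType) (L u : R) : `|u| <= L / 2 + tail L u.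
Proof. by rewrite -lerBlDl /tail le_max lexx. Qed.

Lemma nnmeas_tail (R : realType) d (T : measurableType d) (L : R) (X : T -> R) :
  measurable_fun setT X -> nnmeas (fun w => tail L (X w)).
Proof.
move=> mX; split=> [|w]; last exact: tail_ge0.
by apply: measurable_maxr => //; apply: measurable_funB => //; exact: measurableT_comp.
Qed.

(** The index type is general so that vectors (['I_d]) and scalars ([unit], when couplings are
    glued) share the same results. *)
Definition weight {R : realType} {I : finType} (n : nat) (L : R)
    (f : {ffun I -> 'I_n.+1}) (x : I -> R) : R :=
  \prod_i bern n (f i) ((1 + sin (x i / L)) / 2).

Lemma half_sin01 (R : realType) (u : R) : 0 <= (1 + sin u) / 2 <= 1.
Proof. by have := sin_geN1 u; have := sin_le1 u; move=> ? ?; apply/andP; split; lra. Qed.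

Lemma weight_ge0 (R : realType) (I : finType) n (L : R) (f : {ffun I -> 'I_n.+1}) x :
  0 <= weight L f x.
Proof. by apply: prodr_ge0 => i _; apply: bern_ge0; exact: half_sin01. Qed.

Lemma weight_sum (R : realType) (I : finType) n (L : R) (x : I -> R) :
  \sum_(f : {ffun I -> 'I_n.+1}) weight L f x = 1.
Proof.
rewrite /weight -(bigA_distr_bigA
  (fun i (k : 'I_n.+1) => bern n k ((1 + sin (x i / L)) / 2))).
by apply: big1 => i _; rewrite bern_sum.
Qed.

(** The weights form a product law on [f], so a term that depends on [f i] alone sees only the
    [i]-th marginal; the other factors sum to 1. *)
Lemma weight_mean (R : realType) (I : finType) n (L : R) (x : I -> R)
    (h : I -> 'I_n.+1 -> R) :
  \sum_(f : {ffun I -> 'I_n.+1}) weight L f x * (\sum_i h i (f i)) =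
  \sum_i \sum_(k < n.+1) bern n k ((1 + sin (x i / L)) / 2) * h i k.
Proof.
under eq_bigr do rewrite mulr_sumr.
rewrite exchange_big/=; apply: eq_bigr => i _.
(* Inserting [h i] into the factor of index [i] makes the summand a product again, so that sum and
   product can be exchanged. *)
pose F j (k : 'I_n.+1) :=
  bern n k ((1 + sin (x j / L)) / 2) * (if j == i then h i k else 1).
transitivity (\sum_(f : {ffun I -> 'I_n.+1}) \prod_j F j (f j)).
  apply: eq_bigr => f _; rewrite /F big_split/=; congr (_ * _).
  by rewrite -big_mkcond/= big_pred1_eq.
rewrite -(bigA_distr_bigA F) (bigD1 i)//= [X in _ * X]big1 ?mulr1.
  by apply: eq_bigr => k _; rewrite /F eqxx.
move=> j /negbTE ji; rewrite -[RHS](bern_sum n ((1 + sin (x j / L)) / 2)).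
by apply: eq_bigr => k _; rewrite /F ji mulr1.
Qed.

Lemma nnmeas_weight (R : realType) (I : finType) n (L : R) (f : {ffun I -> 'I_n.+1})
    d (T : measurableType d) (Y : I -> T -> R) :
  (forall i, measurable_fun setT (Y i)) -> nnmeas (fun w => weight L f (Y ^~ w)).
Proof.
move=> mY; apply: nnmeas_prod => i; split => [|w]; last by apply: bern_ge0; exact: half_sin01.
have my : measurable_fun setT (fun w => (1 + sin (Y i w / L)) / 2).
  apply: measurable_funM => //; apply: measurable_funD => //.
  apply: (@measurableT_comp _ _ _ _ _ _ sin).
    by apply: continuous_measurable_fun; exact: continuous_sin.
  exact: measurable_funM.
suff mb m k : measurable_fun setT (fun w => bern m k ((1 + sin (Y i w / L)) / 2)) by exact: mb.
elim: m k => [|m IHm] k //=.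
apply: measurable_funD; first by apply: measurable_funM => //; exact: measurable_funB.
by case: k => // k; exact: measurable_funM.
Qed.

Lemma bern_localized_scaled (R : realType) n (z : 'I_n.+1 -> R) (delta L u : R) :
  0 < L ->
  localized z delta ->
  `|u| <= L ->
  \sum_(k < n.+1) bern n k ((1 + sin (u / L)) / 2) * `|u - L * z k| <= L * delta.
Proof.
move=> L0 loc uL.
have uL1 : `|u / L| <= 1 by rewrite normrM normfV (gtr0_norm L0) ler_pdivrMr// mul1r.
apply: le_trans (ler_wpM2l (ltW L0) (loc _ uL1)); rewrite mulr_sumr.
apply: ler_sum => k _; rewrite [leRHS]mulrCA; apply: ler_wpM2l.
  by apply: bern_ge0; exact: half_sin01.
by rewrite -[X in X * `|_|](gtr0_norm L0) -normrM mulrBr mulrCA divff ?gt_eqF// mulr1.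
Qed.

Lemma weight_localized_box (R : realType) (I : finType) n (z : 'I_n.+1 -> R)
    (delta L : R) (x : I -> R) : 0 < L ->
  localized z delta ->
  (forall i, `|x i| <= L) ->
  \sum_(f : {ffun I -> 'I_n.+1}) weight L f x * (\sum_i `|x i - L * z (f i)|) <=
  #|I|%:R * (L * delta).
Proof.
move=> L0 loc xL; rewrite (weight_mean L x (fun i k => `|x i - L * z k|)).
rewrite mulr_natl -sumr_const; apply: ler_sum => i _.
exact: bern_localized_scaled.
Qed.

(** Coordinates are treated one at a time: those in [-L, L] by localization, the others by the crude
    bound |x_i| + L on the distance to any node. *)
Lemma weight_localized (R : realType) (I : finType) n (z : 'I_n.+1 -> R) (delta L : R)
    (x : I -> R) : 0 < L -> (forall k, `|z k| <= 1) ->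
  localized z delta ->
  \sum_(f : {ffun I -> 'I_n.+1}) weight L f x * (\sum_i `|x i - L * z (f i)|) <=
  \sum_i (L * delta + 4 * tail L (x i)).
Proof.
move=> L0 z1 loc; rewrite (weight_mean L x (fun i k => `|x i - L * z k|)).
apply: ler_sum => i _; have [xL|xL] := leP `|x i| L.
  apply: (@le_trans _ _ (L * delta)); first exact: bern_localized_scaled.
  by rewrite lerDl mulr_ge0// tail_ge0.
apply: (@le_trans _ _ (4 * tail L (x i))).
  (* The constant 4 comes from |x_i| + L <= 4 (|x_i| - L / 2), which holds exactly when |x_i| >=
     L. *)
  have -> : 4 * tail L (x i) =
      \sum_(k < n.+1) bern n k ((1 + sin (x i / L)) / 2) * (4 * tail L (x i)).
    by rewrite -mulr_suml bern_sum mul1r.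
  apply: ler_sum => k _; apply: ler_wpM2l; first by apply: bern_ge0; exact: half_sin01.
  apply: le_trans (ler_normB _ _) _; rewrite normrM (gtr0_norm L0).
  have : L * `|z k| <= L by rewrite ler_piMr// ltW.
  have : `|x i| - L / 2 <= tail L (x i) by rewrite /tail le_max lexx.
  by move: xL; move: (L * `|z k|) (tail L (x i)) => ? ?; lra.
rewrite lerDr mulr_ge0// ?(ltW L0)//; apply: le_trans (loc 0 _); last by rewrite normr0.
by apply: sumr_ge0 => k _; rewrite mulr_ge0 ?bern_ge0 ?half_sin01.
Qed.

(** Each cell is compared with its node, once from each side: this gives 2 delta and four times the
    tails. For the leftover mass, |Y1 - Y2| <= L + tails in each coordinate, which gives [M] = #|I|
    L and one more copy of the tails, hence the factor 5. *)
Lemma box_coupling (R : realType) d1 (T1 : measurableType d1) d2 (T2 : measurableType d2)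
    (P1 : probability T1 R) (P2 : probability T2 R) (I : finType)
    (Y1 : I -> T1 -> R) (Y2 : I -> T2 -> R) n (z : 'I_n.+1 -> R) (delta L : R) :
  (forall i, measurable_fun setT (Y1 i)) -> (forall i, measurable_fun setT (Y2 i)) ->
  0 < L -> (forall k, `|z k| <= 1) ->
  localized z delta ->
  exists L' : probability (T1 * T2)%type R,
  [/\ forall A, measurable A -> L' (fst @^-1` A) = P1 A,
      forall A, measurable A -> L' (snd @^-1` A) = P2 A &
      (\int[L']_w (\sum_i `|Y1 i w.1 - Y2 i w.2|)%:E <=
       (#|I|%:R * L * (2 * delta + (1 - \sum_(f : {ffun I -> 'I_n.+1})
         Num.min (fine (\int[P1]_w (weight L f (Y1 ^~ w))%:E))
                 (fine (\int[P2]_w (weight L f (Y2 ^~ w))%:E)))))%:E +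
       5%:E * (\int[P1]_w (\sum_i tail L (Y1 i w))%:E +
               \int[P2]_w (\sum_i tail L (Y2 i w))%:E))%E].
Proof.
move=> mY1 mY2 L0 z1 loc.
have [L' [m1 m2 H]] := partition_coupling P1 P2
  (fun f => nnmeas_weight L f mY1) (fun w => weight_sum n L (Y1 ^~ w))
  (fun f => nnmeas_weight L f mY2) (fun w => weight_sum n L (Y2 ^~ w)).
exists L'; split=> //.
set S1 := fun w => \sum_i tail L (Y1 i w); set S2 := fun w => \sum_i tail L (Y2 i w).
have nS1 : nnmeas S1 by apply: nnmeas_sum => i; exact: nnmeas_tail.
have nS2 : nnmeas S2 by apply: nnmeas_sum => i; exact: nnmeas_tail.
pose a d (T : measurableType d) (Y : I -> T -> R) (f : {ffun I -> 'I_n.+1}) w :=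
  \sum_i `|Y i w - L * z (f i)|.
have na d (T : measurableType d) (Y : I -> T -> R) (f : {ffun I -> 'I_n.+1}) :
    (forall i, measurable_fun setT (Y i)) -> nnmeas (a _ _ Y f).
  by move=> mY; apply: nnmeas_sum => i; apply: nnmeas_norm; exact: measurable_funB.
have d0 : 0 <= delta.
  apply: le_trans (loc 0 _); last by rewrite normr0.
  by apply: sumr_ge0 => k _; rewrite mulr_ge0 ?bern_ge0 ?half_sin01.
have step d (T : measurableType d) (P : probability T R) (Y : I -> T -> R) :
    (forall i, measurable_fun setT (Y i)) ->
    (\int[P]_w (\sum_f a _ _ Y f w * weight L f (Y ^~ w))%:E <=
     (#|I|%:R * L * delta)%:E + 4%:E * \int[P]_w (\sum_i tail L (Y i w))%:E)%E.
  move=> mY.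
  have nS : nnmeas (fun w => \sum_i tail L (Y i w)).
    by apply: nnmeas_sum => i; exact: nnmeas_tail.
  have c0 : 0 <= #|I|%:R * L * delta by rewrite !mulr_ge0// ltW.
  rewrite -nnintZ// -[X in (X + _)%E](nnint_cst P) -nnintD; first last.
  - by apply: nnmeasM => //; exact: nnmeas_cst.
  - exact: nnmeas_cst.
  apply: nnint_le => [||w].
  - by apply: nnmeas_sum => f; apply: nnmeasM; [exact: na|exact: nnmeas_weight].
  - by apply: nnmeasD; [exact: nnmeas_cst|apply: nnmeasM => //; exact: nnmeas_cst].
  under eq_bigr do rewrite mulrC.
  apply: le_trans (weight_localized _ L0 z1 loc) _.
  by rewrite big_split/= sumr_const -mulr_sumr -[_ *+ #|_|]mulr_natl mulrA.
have := H (fun w => \sum_i `|Y1 i w.1 - Y2 i w.2|) (a _ _ Y1) (a _ _ Y2)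
  (#|I|%:R * L) S1 S2.
set r := 1 - _ => {}H; apply: le_trans (H _ _ _ _ _ _ _ _) _ => //.
- apply: nnmeas_sum => i; apply: nnmeas_norm; apply: measurable_funB.
  + exact: measurableT_comp.
  + exact: measurableT_comp.
- by move=> f; exact: na.
- by move=> f; exact: na.
- by rewrite mulr_ge0// ltW.
- move=> f w; rewrite -big_split/=; apply: ler_sum => i _.
  by rewrite [X in _ <= _ + X]distrC; exact: ler_distD.
- move=> w; rewrite /S1 /S2 -big_split/= mulr_natl -sumr_const -big_split/=.
  apply: ler_sum => i _; apply: le_trans (ler_normB _ _) _.
  have := norm_le_tail L (Y1 i w.1); have := norm_le_tail L (Y2 i w.2).
  by move: (tail _ _) (tail _ _) => ? ?; lra.
apply: le_trans (leeD (leeD (leeD (step _ _ P1 _ mY1) (step _ _ P2 _ mY2))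
  (lexx _)) (lexx _)) _.
rewrite -/S1 -/S2.
have [x0 y0] := (nnint_ge0 P1 nS1, nnint_ge0 P2 nS2); move: x0 y0.
move: (\int[P1]_w _)%E (\int[P2]_w _)%E => x y x0 y0.
(* With infinite tails the bound is [+oo]; otherwise the comparison is one between reals. *)
have [xy|xy] := eqVneq (x + y)%E +oo%E.
  by rewrite xy gt0_muley ?lte_fin ?ltr0n// [leRHS]addey// leey.
have xf : x \is a fin_num.
  rewrite ge0_fin_numE// ltNge leye_eq; apply: contra xy => /eqP ->.
  by rewrite addye// gt_eqF// (lt_le_trans _ y0).
have yf : y \is a fin_num.
  rewrite ge0_fin_numE// ltNge leye_eq; apply: contra xy => /eqP ->.
  by rewrite addey// gt_eqF// (lt_le_trans _ x0).
rewrite -(fineK xf) -(fineK yf) -!(EFinM, EFinD) lee_fin.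
by move: (fine x) (fine y) (#|I|%:R * L) => ? ? ?; lra.
Qed.

(** * Ridge functions and trigonometric polynomials *)

Lemma continuous_measurable_Rd (R : realType) d (f : 'rV[R]_d -> R) :
  continuous f -> measurable_fun setT (f : Rd R d -> R).
Proof.
move=> /continuousP cf; apply: (measurability _ (RGenOInfty.measurableE R)).
move=> _ [_ [a ->] <-]; rewrite setTI; apply: sub_sigma_algebra.
by apply: cf; exact: interval_open.
Qed.

Lemma continuous_dotv (R : realType) d (t : 'rV[R]_d) : continuous (dotv t).
Proof.
apply: continuous_big; first by move=> x; exact: add_continuous.
move=> i _ x; apply: (@continuousM R 'rV[R]_d (fun=> t 0 i) (fun x => x 0 i)).
  exact: cst_continuous.
exact: coord_continuous.
Qed.

Lemma measurable_coord (R : realType) d (i : 'I_d) :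
  measurable_fun setT (fun x : Rd R d => (x : 'rV[R]_d) 0 i).
Proof. exact: (continuous_measurable_Rd (@coord_continuous _ _ _ 0 i)). Qed.

Lemma measurable_dotv (R : realType) d (t : 'rV[R]_d) :
  measurable_fun setT (fun x : Rd R d => dotv t x).
Proof. exact: (continuous_measurable_Rd (@continuous_dotv _ _ t)). Qed.

Lemma nnmeas_enorm (R : realType) d dT (T : measurableType dT) (X : 'I_d -> T -> R) :
  (forall i, measurable_fun setT (X i)) ->
  nnmeas (fun w => Num.sqrt (\sum_i X i w ^+ 2)).
Proof.
move=> mX; split=> [|w]; last exact: sqrtr_ge0.
apply: (@measurableT_comp _ _ _ _ _ _ (@Num.sqrt R)).
  by apply: continuous_measurable_fun; exact: sqrt_continuous.
by apply: measurable_sum => i; exact: measurable_funX.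
Qed.

(** * Euclidean norm, scalar product and unit sphere *)

Lemma enorm_ge0 (R : realType) d (x : 'rV[R]_d) : 0 <= enorm x.
Proof. exact: sqrtr_ge0. Qed.

Lemma enorm_sqr (R : realType) d (x : 'rV[R]_d) : enorm x ^+ 2 = \sum_i x 0 i ^+ 2.
Proof. by rewrite sqr_sqrtr// sumr_ge0// => i _; exact: sqr_ge0. Qed.

Lemma coord_le_enorm (R : realType) d (x : 'rV[R]_d) i : `|x 0 i| <= enorm x.
Proof.
rewrite -(@ler_pXn2r _ 2) ?nnegrE ?enorm_ge0// enorm_sqr real_normK ?num_real//.
by rewrite (bigD1 i)//= lerDl sumr_ge0// => j _; exact: sqr_ge0.
Qed.

Lemma sqr_sum_le (R : realType) (I : Type) (s : seq I) (F : I -> R) :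
  (forall i, 0 <= F i) -> \sum_(i <- s) F i ^+ 2 <= (\sum_(i <- s) F i) ^+ 2.
Proof.
move=> F0; elim: s => [|i s IHs]; first by rewrite !big_nil expr0n.
rewrite !big_cons sqrrD; have := F0 i; have : 0 <= \sum_(j <- s) F j by exact: sumr_ge0.
move: IHs; move: (\sum_(j <- s) F j) (\sum_(j <- s) _) => a b ba a0 F0i.
by rewrite -addrA lerD2l (le_trans ba)// lerDr mulrn_wge0// mulr_ge0.
Qed.

Lemma enorm_le_sum (R : realType) d (x : 'rV[R]_d) : enorm x <= \sum_i `|x 0 i|.
Proof.
rewrite -(@ler_pXn2r _ 2) ?nnegrE ?enorm_ge0 ?sumr_ge0// enorm_sqr.
under eq_bigr do rewrite -real_normK ?num_real//.
exact: sqr_sum_le.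
Qed.

(** Cauchy-Schwarz: with A = |t|^2, B = |x|^2 and C = t'x, the sum of squares |A x - C t|^2 equals A
    (A B - C^2). If A = 0 then t = 0. *)
Lemma dotv_le (R : realType) d (t x : 'rV[R]_d) : `|dotv t x| <= enorm t * enorm x.
Proof.
rewrite -(@ler_pXn2r _ 2) ?nnegrE ?mulr_ge0 ?enorm_ge0// real_normK ?num_real//.
rewrite exprMn !enorm_sqr.
set A := \sum_i _; set B := \sum_i _; set C := dotv t x.
have A0 : 0 <= A by apply: sumr_ge0 => i _; exact: sqr_ge0.
have : 0 <= \sum_i (A * x 0 i - C * t 0 i) ^+ 2 by apply: sumr_ge0 => i _; exact: sqr_ge0.
have -> : \sum_i (A * x 0 i - C * t 0 i) ^+ 2 = A * (A * B - C ^+ 2).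
  under eq_bigr => i _.
    rewrite (_ : _ ^+ 2 = A ^+ 2 * x 0 i ^+ 2 + - (2 * A * C) * (t 0 i * x 0 i) +
      C ^+ 2 * t 0 i ^+ 2); last by ring.
    over.
  by rewrite !big_split/= -!mulr_sumr -/A -/B -/(dotv t x) -/C; ring.
have [A_eq0 _|A_neq0] := eqVneq A 0.
  have t0 i : t 0 i = 0.
    apply/eqP; rewrite -sqrf_eq0 eq_le sqr_ge0 andbT -A_eq0 /A (bigD1 i)//= lerDl.
    by apply: sumr_ge0 => j _; exact: sqr_ge0.
  rewrite A_eq0 mul0r /C /dotv big1 ?expr0n// => i _.
  by rewrite t0 mul0r.
by rewrite pmulr_rge0 ?lt0r ?A_neq0// subr_ge0.
Qed.

Lemma dotvB (R : realType) d (t x y : 'rV[R]_d) : dotv t (x - y) = dotv t x - dotv t y.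
Proof. by rewrite /dotv -sumrB; apply: eq_bigr => i _; rewrite !mxE mulrBr. Qed.

Lemma dotvDl (R : realType) d (s t x : 'rV[R]_d) : dotv (s + t) x = dotv s x + dotv t x.
Proof. by rewrite /dotv -big_split; apply: eq_bigr => i _; rewrite !mxE mulrDl. Qed.

Lemma dotvZl (R : realType) d a (t x : 'rV[R]_d) : dotv (a *: t) x = a * dotv t x.
Proof. by rewrite /dotv mulr_sumr; apply: eq_bigr => i _; rewrite !mxE mulrA. Qed.

Lemma dotv_delta (R : realType) d i (x : 'rV[R]_d) : dotv (delta_mx 0 i) x = x 0 i.
Proof.
rewrite /dotv (bigD1 i)//= big1 ?addr0 => [|j ji]; rewrite !mxE eqxx /= ?eqxx ?mul1r//.
by rewrite (negbTE ji) mul0r.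
Qed.

Lemma sphere_delta (R : realType) d (i : 'I_d) : sphere R d (delta_mx 0 i).
Proof.
rewrite /sphere/= /enorm (bigD1 i)//= big1 ?addr0 => [|j ji].
  by rewrite mxE !eqxx expr1n sqrtr1.
by rewrite mxE (negbTE ji) andbF expr0n.
Qed.

Lemma sphere_normalize (R : realType) d (t : 'rV[R]_d) : t != 0 ->
  exists2 s, sphere R d s & t = enorm t *: s.
Proof.
move=> t0; have e0 : enorm t != 0.
  apply: contra t0 => /eqP e0; apply/eqP/rowP => i; rewrite mxE.
  by apply/eqP; rewrite -normr_le0 -e0 coord_le_enorm.
exists ((enorm t)^-1 *: t); last by rewrite scalerA divff// scale1r.
have ep : 0 < enorm t by rewrite lt0r e0 enorm_ge0.
apply/eqP; rewrite -(@eqrXn2 _ 2) ?enorm_ge0// enorm_sqr expr1n.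
under eq_bigr do rewrite mxE exprMn.
by rewrite -mulr_sumr -enorm_sqr -exprMn mulVf// expr1n.
Qed.

(** * Trigonometric polynomials *)

(** The phase [a] lets cosines cover sines as well, and the frequency 0 covers the constants. *)
Inductive trig {R : realType} {d} : ('rV[R]_d -> R) -> Prop :=
| trig_cos t a : trig (fun x => cos (dotv t x + a))
| trigD f g : trig f -> trig g -> trig (fun x => f x + g x)
| trigZ c f : trig f -> trig (fun x => c * f x).

Lemma trig_ext (R : realType) d (f g : 'rV[R]_d -> R) : f =1 g -> trig f -> trig g.
Proof. by move=> /funext <-. Qed.

Lemma trig_cst (R : realType) d (c : R) : trig (fun _ : 'rV[R]_d => c).
Proof.
apply: trig_ext (trigZ c (trig_cos 0 0)) => x.
by rewrite /dotv big1 ?addr0 ?cos0 ?mulr1// => i _; rewrite mxE mul0r.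
Qed.

(** Two cosines multiply to half the sum of the cosines of the sum and the difference of their
    arguments; bilinearity does the rest. *)
Lemma trigM (R : realType) d (f g : 'rV[R]_d -> R) :
  trig f -> trig g -> trig (fun x => f x * g x).
Proof.
move=> tf; elim: tf g => [t a g tg|f1 f2 _ IH1 _ IH2 g tg|c f1 _ IH g tg].
- elim: tg => [s b|g1 g2 _ IH1 _ IH2|c g1 _ IH].
  + apply: trig_ext (trigZ (2^-1) (trigD (trig_cos (t + s) (a + b))
      (trig_cos (t + -1 *: s) (a - b)))) => x.
    rewrite !dotvDl dotvZl mulN1r.
    rewrite (_ : _ + _ + (a + b) = (dotv t x + a) + (dotv s x + b)); last by ring.
    rewrite (_ : _ - _ + (a - b) = (dotv t x + a) - (dotv s x + b)); last by ring.
    by rewrite cosD cosB; field.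
  + by apply: trig_ext (trigD IH1 IH2) => x; ring.
  + by apply: trig_ext (trigZ c IH) => x; ring.
- by apply: trig_ext (trigD (IH1 _ tg) (IH2 _ tg)) => x; ring.
- by apply: trig_ext (trigZ c (IH _ tg)) => x; ring.
Qed.

(** A sine is a cosine with phase - pi / 2, and the recursion for [bern] uses sums and products
    only. *)
Lemma trig_weight (R : realType) d n (L : R) (f : {ffun 'I_d -> 'I_n.+1}) :
  trig (fun x : 'rV[R]_d => weight L f (x 0)).
Proof.
rewrite /weight; elim: (index_enum _) => [|i s IHs].
  by apply: trig_ext (trig_cst d 1) => x; rewrite big_nil.
suff tb : trig (fun x : 'rV[R]_d => bern n (f i) ((1 + sin (x 0 i / L)) / 2)).
  by apply: trig_ext (trigM tb IHs) => x; rewrite big_cons.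
have ty : trig (fun x : 'rV[R]_d => (1 + sin (x 0 i / L)) / 2).
  apply: trig_ext (trigZ 2^-1 (trigD (trig_cst d 1)
    (trig_cos (L^-1 *: delta_mx 0 i) (- (pi / 2))))) => x.
  by rewrite dotvZl dotv_delta cosBpihalf mulrC (mulrC L^-1).
move: (nat_of_ord _) => k; elim: {f IHs} n k => [|n IHn] k; first exact: trig_cst.
have ty' : trig (fun x : 'rV[R]_d => 1 - (1 + sin (x 0 i / L)) / 2).
  by apply: trig_ext (trigD (trig_cst d 1) (trigZ (-1) ty)) => x; ring.
apply: trigD; first exact: trigM.
by case: k => [|k]; [exact: trig_cst|exact: trigM].
Qed.

(** * Approximation of functions of linear growth *)

(** The box is compact, and compactness in its near-covering form makes the local choice of [eta]
    uniform in [x]. *)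
Lemma box_uniform_continuity (R : realType) d (f : 'rV[R]_d -> R) (L eps : R) :
  continuous f -> 0 < eps -> exists2 eta, 0 < eta &
    forall x y : 'rV[R]_d, (forall i, `|x 0 i| <= L) ->
      (forall i, `|x 0 i - y 0 i| < eta) -> `|f x - f y| <= eps.
Proof.
move=> cf eps0.
have cK : compact [set x : 'rV[R]_d | forall i, `[- L, L]%classic (x ord0 i)].
  by apply: (@rV_compact _ _ (fun=> `[- L, L]%classic)) => i; exact: segment_compact.
move/compact_near_coveringP: cK => /(_ R (nbhs 0^'+)
  (fun eta x => forall y : 'rV[R]_d,
    (forall i, `|x 0 i - y 0 i| < eta) -> `|f x - f y| <= eps)).
case.
- move=> x _; have /cvgrPdist_lt/(_ (eps / 2)) := cf x.
  rewrite divr_gt0// => /(_ isT) /nbhs_ballP[r /= r0 fr].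
  exists (ball x (r / 2), [set eta | eta < r / 2]).
    split; first by apply: nbhsx_ballx; rewrite divr_gt0.
    by apply: nbhs_right_lt; rewrite divr_gt0.
  move=> [x' eta] /= [[_ xx'] etar] y x'y.
  have fx' : `|f x - f x'| < eps / 2.
    by apply: fr; split=> // i j; apply: le_ball (xx' i j); lra.
  have fy : `|f x - f y| < eps / 2.
    apply: fr; split=> // i j; rewrite (ord1 i).
    have := xx' 0 j; have := x'y j; rewrite /ball/= => h1 h2.
    by apply: le_lt_trans (ler_distD (x' 0 j) _ _) _; lra.
  by apply: le_trans (ler_distD (f x) _ _) _; rewrite (distrC (f x')); lra.
- move=> eta /= eta0 H; exists (eta / 2); first by rewrite divr_gt0.
  move=> x y xL; apply: (H (eta / 2)).
  + by rewrite /ball/= sub0r normrN gtr0_norm; lra.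
  + by rewrite divr_gt0.
  + by move=> i /=; rewrite in_itv/= -ler_norml; exact: xL.
Qed.

(** The order of quantifiers matters: [C] depends neither on [L] nor on [eps], so [L] can be chosen
    afterwards to make C times the tails small, and only then [delta]. *)
Lemma Dd_approx (R : realType) d (f : 'rV[R]_d -> R) : Dd R d f ->
  exists2 C, 0 <= C & forall L eps, 1 <= L -> 0 < eps ->
  exists2 delta, 0 < delta & forall n (z : 'I_n.+1 -> R),
    (forall k, `|z k| <= 1) ->
    localized z delta ->
    forall x : 'rV[R]_d,
    `|f x - \sum_(g : {ffun 'I_d -> 'I_n.+1}) f (\row_i (L * z (g i))) * weight L g (x 0)|
      <= eps + C * \sum_i tail L (x 0 i).
Proof.
move=> [cf [C0 fC]].
have C0_ge0 : 0 <= C0.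
  have := le_trans (normr_ge0 _) (fC 0); rewrite pmulr_lge0//.
  by rewrite lt_max ltr01.
(* Let s be the sum of the |x_i| and t that of the tails. Outside of the box, |f x| plus |f| at a
   node is at most C0 (2 + s + d L). Here 1 <= L <= 2 t and s <= d L / 2 + t, which adds up to C0 (5
   + 3 d) t. *)
exists (C0 * (5 + 3 * d%:R)).
  by rewrite mulr_ge0 ?addr_ge0 ?mulr_ge0 ?ler0n.
move=> L eps L1 eps0; have L0 : 0 < L by rewrite (lt_le_trans ltr01).
have fS (x : 'rV[R]_d) : `|f x| <= C0 * (1 + \sum_i `|x 0 i|).
  apply: le_trans (fC x) _; rewrite ler_wpM2l// ge_max lerDl sumr_ge0//=.
  by rewrite (le_trans (enorm_le_sum x))// lerDr.
have fbox (x : 'rV[R]_d) : (forall i, `|x 0 i| <= L) -> `|f x| <= C0 * (1 + d%:R * L).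
  move=> xL; apply: le_trans (fS x) _; rewrite ler_wpM2l// lerD2l.
  rewrite mulr_natl -[X in _ *+ X]card_ord -sumr_const; apply: ler_sum => i _; exact: xL.
have eps2 : 0 < eps / 2 by rewrite divr_gt0.
have [eta eta0 fu] := box_uniform_continuity L cf eps2.
pose S := C0 * (1 + d%:R * L); pose K := 2 * S / eta.
have S0 : 0 <= S by rewrite mulr_ge0// addr_ge0// mulr_ge0// ltW.
have K0 : 0 <= K by apply: divr_ge0; [exact: mulr_ge0|exact: ltW].
(* Uniform continuity in Lipschitz form: when some coordinate moves by at least [eta], the trivial
   bound 2 S = K eta suffices. *)
have fK (x y : 'rV[R]_d) : (forall i, `|x 0 i| <= L) -> (forall i, `|y 0 i| <= L) ->
    `|f x - f y| <= eps / 2 + K * \sum_i `|x 0 i - y 0 i|.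
  move=> xL yL.
  have s0 : 0 <= \sum_i `|x 0 i - y 0 i| by exact: sumr_ge0.
  have [/forallP xy|] := boolP [forall i, `|x 0 i - y 0 i| < eta].
    by apply: le_trans (fu x y xL xy) _; rewrite lerDl mulr_ge0.
  rewrite negb_forall => /existsP[i]; rewrite -leNgt => xyi.
  apply: (@le_trans _ _ (2 * S)).
    apply: le_trans (ler_normB _ _) _; have := fbox x xL; have := fbox y yL.
    by rewrite -/S; lra.
  apply: (@le_trans _ _ (K * eta)); first by rewrite /K divfK ?gt_eqF.
  apply: (@le_trans _ _ (K * \sum_i `|x 0 i - y 0 i|)); last by rewrite lerDr ltW.
  by rewrite ler_wpM2l// (le_trans xyi)// (bigD1 i)//= lerDl sumr_ge0.
(* The localization error d L delta gets multiplied by [K]; dividing eps / 2 by [D] keeps the result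
   below eps / 2, and the summand 1 keeps [D] positive. *)
pose D := K * (d%:R * L) + 1.
have D0 : 0 < D.
  apply: ltr_wpDl => //; apply: mulr_ge0 => //; apply: mulr_ge0 => //; exact: ltW.
exists (eps / 2 / D); first by rewrite divr_gt0.
move=> n z z1 loc x.
have nodeL (g : {ffun 'I_d -> 'I_n.+1}) i : `|(\row_i (L * z (g i)) : 'rV[R]_d) 0 i| <= L.
  by rewrite mxE normrM (gtr0_norm L0) ler_piMr// ltW.
have w0 (g : {ffun 'I_d -> 'I_n.+1}) : 0 <= weight L g (x 0) by exact: weight_ge0.
have wsum := weight_sum n L (x 0).
have tail0 : 0 <= \sum_i tail L (x 0 i) by apply: sumr_ge0 => i _; exact: tail_ge0.
have -> : f x -
    \sum_(g : {ffun 'I_d -> 'I_n.+1}) f (\row_i (L * z (g i))) * weight L g (x 0) =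
    \sum_(g : {ffun 'I_d -> 'I_n.+1}) weight L g (x 0) * (f x - f (\row_i (L * z (g i)))).
  under [RHS]eq_bigr do rewrite mulrBr.
  rewrite sumrB -mulr_suml wsum mul1r; congr (_ - _).
  by apply: eq_bigr => g _; rewrite mulrC.
apply: le_trans (ler_norm_sum _ _ _) _.
under eq_bigr => g _ do rewrite normrM ger0_norm//.
have [/forallP xL|] := boolP [forall i, `|x 0 i| <= L].
  apply: (@le_trans _ _ (\sum_(g : {ffun 'I_d -> 'I_n.+1}) weight L g (x 0) *
      (eps / 2 + K * \sum_i `|x 0 i - L * z (g i)|))).
    apply: ler_sum => g _; rewrite ler_wpM2l//; apply: le_trans (fK _ _ xL (nodeL g)) _.
    by under eq_bigr do rewrite mxE.
  under eq_bigr do rewrite mulrDr (mulrCA _ K).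
  rewrite big_split/= -mulr_suml wsum mul1r -mulr_sumr.
  have := ler_wpM2l K0 (weight_localized_box L0 loc xL).
  rewrite card_ord => H.
  apply: (@le_trans _ _ (eps / 2 + eps / 2)).
    rewrite lerD2l (le_trans H)//.
    have -> : K * (d%:R * (L * (eps / 2 / D))) = K * (d%:R * L) * (eps / 2) / D.
      by rewrite !mulrA.
    rewrite ler_pdivrMr// [leRHS]mulrC; apply: ler_wpM2r; first exact: ltW.
    by rewrite /D lerDl.
  by rewrite -splitr lerDl mulr_ge0// mulr_ge0// addr_ge0// mulr_ge0.
rewrite negb_forall => /existsP[i]; rewrite -ltNge => xi.
apply: (@le_trans _ _ (C0 * (5 + 3 * d%:R) * \sum_i tail L (x 0 i))); last by rewrite lerDr ltW.
apply: (@le_trans _ _ (\sum_(g : {ffun 'I_d -> 'I_n.+1}) weight L g (x 0) *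
    (C0 * (1 + \sum_i `|x 0 i|) + S))).
  apply: ler_sum => g _; rewrite ler_wpM2l//; apply: le_trans (ler_normB _ _) _.
  exact: lerD (fS x) (fbox _ (nodeL g)).
rewrite -mulr_suml wsum mul1r /S -mulrDr -mulrA ler_wpM2l//.
have : \sum_i `|x 0 i| <= d%:R * (L / 2) + \sum_i tail L (x 0 i).
  rewrite mulr_natl -[X in _ *+ X]card_ord -sumr_const -big_split/=.
  by apply: ler_sum => j _; exact: norm_le_tail.
have : L / 2 <= \sum_i tail L (x 0 i).
  rewrite (bigD1 i)//= -[leLHS]addr0 lerD//; last by apply: sumr_ge0 => j _; exact: tail_ge0.
  by have := norm_le_tail L (x 0 i); lra.
move: (\sum_i tail _ _) (\sum_i `|_|) tail0 => t s t0 Lt st.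
have dt : d%:R * L <= d%:R * (2 * t) by rewrite ler_wpM2l//; lra.
by lra.
Qed.

(** * Wasserstein distances *)

Lemma coupling_nnint (R : realType) dT (T : measurableType dT) dU (U : measurableType dU)
    (P : probability T R) (X Y : T -> U) (lam : probability (U * U)%type R) (g : U -> R) :
  measurable_fun setT X -> measurable_fun setT Y -> coupling P X Y lam -> nnmeas g ->
  (\int[lam]_z (g z.1)%:E = \int[P]_w (g (X w))%:E)%E /\
  (\int[lam]_z (g z.2)%:E = \int[P]_w (g (Y w))%:E)%E.
Proof.
move=> mX mY cpl ng; split.
- by apply: (@nnint_same_law _ _ _ _ _ _ _ lam P fst X) => // A /cpl[].
- by apply: (@nnint_same_law _ _ _ _ _ _ _ lam P snd Y) => // A /cpl[].
Qed.

Lemma W1c_ge0 (R : realType) dT (T : measurableType dT) dU (U : measurableType dU)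
    (c : U -> U -> R) (P : probability T R) (X Y : T -> U) :
  (forall x y, 0 <= c x y) -> (0 <= W1c c P X Y)%E.
Proof.
by move=> c0; apply: le_ereal_inf_tmp => _ [lam _ <-]; apply: integral_ge0 => z _; rewrite lee_fin.
Qed.

(** The law of (A, B) under [Q] is a coupling. Couplings can therefore be built on any convenient
    space that carries copies of [X] and [Y]. *)
Lemma W1c_le_image (R : realType) dT (T : measurableType dT) dU (U : measurableType dU)
    (c : U -> U -> R) (P : probability T R) (X Y : T -> U)
    dS (S : measurableType dS) (Q : probability S R) (A B : S -> U) :
  measurable_fun setT A -> measurable_fun setT B ->
  nnmeas (fun z : U * U => c z.1 z.2) ->
  (forall E, measurable E -> Q (A @^-1` E) = P (X @^-1` E)) ->
  (forall E, measurable E -> Q (B @^-1` E) = P (Y @^-1` E)) ->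
  (W1c c P X Y <= \int[Q]_s (c (A s) (B s))%:E)%E.
Proof.
move=> mA mB nc hA hB.
have mAB : measurable_fun setT (fun s => (A s, B s)) by exact: measurable_fun_pair.
have [lam [lamE lamI]] := image_probability Q mAB.
apply: ereal_inf_lbound; exists lam; last by rewrite lamI.
by move=> E mE; rewrite !lamE; split; [rewrite -hA|rewrite -hB].
Qed.

Lemma nnmeas_dist (R : realType) :
  nnmeas (fun z : measurableTypeR R * measurableTypeR R => `|z.1 - z.2| : R).
Proof. by apply: nnmeas_norm; exact: measurable_funB. Qed.

Lemma nnmeas_edist (R : realType) d : nnmeas (fun z : Rd R d * Rd R d => enorm (z.1 - z.2)).
Proof.
have := @nnmeas_enorm R d _ (Rd R d * Rd R d)%type
  (fun i z => (z.1 : 'rV[R]_d) 0 i - (z.2 : 'rV[R]_d) 0 i).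
rewrite /enorm => H.
have -> : (fun z : Rd R d * Rd R d => Num.sqrt (\sum_i ((z.1 - z.2) : 'rV[R]_d) 0 i ^+ 2)) =
    (fun z => Num.sqrt (\sum_i ((z.1 : 'rV[R]_d) 0 i - (z.2 : 'rV[R]_d) 0 i) ^+ 2)).
  by apply/funext => z; congr Num.sqrt; apply: eq_bigr => i _; rewrite !mxE.
apply: H => i; apply: measurable_funB.
- exact: (measurableT_comp (measurable_coord (R:=R) i) measurable_fst).
- exact: (measurableT_comp (measurable_coord (R:=R) i) measurable_snd).
Qed.

(** Projecting both components along a unit vector maps couplings to couplings and does not increase
    distances. *)
Lemma W1r_le_W1 (R : realType) d dT (T : measurableType dT) (P : probability T R)
    (X Y : T -> Rd R d) (t : 'rV[R]_d) :
  measurable_fun setT X -> measurable_fun setT Y -> sphere R d t ->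
  (W1r P (fun w => dotv t (X w)) (fun w => dotv t (Y w)) <= W1 P X Y)%E.
Proof.
move=> mX mY t1; apply: le_ereal_inf_tmp => _ [lam /= cpl <-].
have m1 : measurable_fun setT (fun z : Rd R d * Rd R d => dotv t z.1).
  exact: (measurableT_comp (measurable_dotv t) measurable_fst).
have m2 : measurable_fun setT (fun z : Rd R d * Rd R d => dotv t z.2).
  exact: (measurableT_comp (measurable_dotv t) measurable_snd).
apply: (@le_trans _ _ (\int[lam]_z (`|dotv t z.1 - dotv t z.2|)%:E)%E).
  apply: (@W1c_le_image _ _ _ _ _ (fun x y : R => `|x - y|)) => //.
  - exact: nnmeas_dist.
  - move=> E mE; have [-> _] := cpl (dotv t @^-1` E : set (Rd R d))
      ltac:(by rewrite -[X in measurable X]setTI; exact: measurable_dotv).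
    by [].
  - move=> E mE; have [_ ->] := cpl (dotv t @^-1` E : set (Rd R d))
      ltac:(by rewrite -[X in measurable X]setTI; exact: measurable_dotv).
    by [].
apply: nnint_le => [||z].
- by apply: nnmeas_norm; exact: measurable_funB.
- exact: nnmeas_edist.
- by rewrite -dotvB (le_trans (dotv_le _ _))// t1 mul1r.
Qed.

Lemma W1star_le_W1 (R : realType) d dT (T : measurableType dT) (P : probability T R)
    (X Y : T -> Rd R d) : measurable_fun setT X -> measurable_fun setT Y ->
  (W1star P X Y <= W1 P X Y)%E.
Proof. by move=> mX mY; apply: ge_ereal_sup => _ [t t1 <-]; exact: W1r_le_W1. Qed.

Lemma W1r_ge0 (R : realType) dT (T : measurableType dT) (P : probability T R)
    (X Y : T -> R) : (0 <= W1r P X Y)%E.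
Proof. exact: W1c_ge0. Qed.

Lemma W1r_le_W1star (R : realType) d dT (T : measurableType dT) (P : probability T R)
    (X Y : T -> Rd R d) t : sphere R d t ->
  (W1r P (fun w => dotv t (X w)) (fun w => dotv t (Y w)) <= W1star P X Y)%E.
Proof. by move=> t1; apply: ereal_sup_ubound; exists t. Qed.

(** For d = 0 the sphere is empty and the supremum is [-oo], hence the hypothesis [1 <= d]. *)
Lemma W1star_ge0 (R : realType) d dT (T : measurableType dT) (P : probability T R)
    (X Y : T -> Rd R d) : (1 <= d)%N -> (0 <= W1star P X Y)%E.
Proof.
case: d X Y => // d X Y _.
exact: le_trans (W1r_ge0 _ _ _) (W1r_le_W1star _ _ _ (sphere_delta R ord0)).
Qed.

(** * Limits in the extended reals *)

(** The bounds for e = 1 already force finiteness from some index on, so convergence to a real limit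
    can be proved by order alone. *)
Lemma cvge_boundsP (R : realType) (u : nat -> \bar R) (l : R) :
  u n @[n --> \oo] --> l%:E <->
  forall e : R, 0 < e -> \forall n \near \oo, ((l - e)%:E <= u n <= (l + e)%:E)%E.
Proof.
split=> [/fine_cvgP[ufin /cvgrPdist_le ul] e e0|ul].
  near=> n; have ufn : u n \is a fin_num by near: n.
  have : `|l - fine (u n)| <= e by near: n; exact: ul.
  by rewrite -(fineK ufn) !lee_fin ler_norml => /andP[? ?]; apply/andP; split; lra.
apply/fine_cvgP; split.
  near=> n; have /andP[h1 h2] : ((l - 1)%:E <= u n <= (l + 1)%:E)%E by near: n; exact: ul.
  by rewrite fin_numElt (lt_le_trans (ltNyr _) h1) (le_lt_trans h2 (ltry _)).
apply/cvgrPdist_le => e e0; near=> n.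
have : ((l - e)%:E <= u n <= (l + e)%:E)%E by near: n; exact: ul.
move=> /andP[h1 h2].
have ufn : u n \is a fin_num.
  by rewrite fin_numElt (lt_le_trans (ltNyr _) h1) (le_lt_trans h2 (ltry _)).
move: h1 h2; rewrite -(fineK ufn) !lee_fin /= => h1 h2.
by rewrite ler_norml; apply/andP; split; lra.
Unshelve. all: by end_near. Qed.

Lemma cvge_to0 (R : realType) (u : nat -> \bar R) : (forall n, 0 <= u n)%E ->
  (forall e : R, 0 < e -> \forall n \near \oo, (u n <= e%:E)%E) -> u n @[n --> \oo] --> 0%E.
Proof.
move=> u0 ue; apply/cvge_boundsP => e e0; near=> n.
rewrite !add0r; apply/andP; split; last by near: n; exact: ue.
by apply: le_trans (u0 n); rewrite lee_fin oppr_le0 ltW.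
Unshelve. all: by end_near. Qed.

Lemma cvge0_le (R : realType) (u : nat -> \bar R) : u n @[n --> \oo] --> 0%E ->
  forall e : R, 0 < e -> \forall n \near \oo, (u n <= e%:E)%E.
Proof.
move=> /cvge_boundsP u0 e e0; near=> n.
have : ((0 - e)%:E <= u n <= (0 + e)%:E)%E by near: n; exact: u0.
by rewrite !add0r => /andP[].
Unshelve. all: by end_near. Qed.

Lemma cvge0_dominated (R : realType) (u v : nat -> \bar R) :
  (forall n, 0 <= v n <= u n)%E -> u n @[n --> \oo] --> 0%E -> v n @[n --> \oo] --> 0%E.
Proof.
move=> uv u0; apply: cvge_to0 => [n|e e0]; first by have /andP[] := uv n.
by apply: filterS (cvge0_le u0 e0) => n; apply: le_trans; have /andP[] := uv n.
Qed.

(** * Convergence of ridge functions *)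

Lemma lipschitz_continuous (R : realType) (K : R) (h : R -> R) :
  (forall u v, `|h u - h v| <= K * `|u - v|) -> continuous h.
Proof.
move=> hK x; apply/cvgrPdist_lt => e e0.
have K0 : 0 <= K by have := le_trans (normr_ge0 _) (hK 1 0); rewrite subr0 normr1 mulr1.
have K1 : 0 < K + 1 by rewrite ltr_wpDl.
near=> y; apply: le_lt_trans (hK _ _) _.
apply: (@le_lt_trans _ _ ((K + 1) * `|x - y|)); first by rewrite ler_wpM2r// lerDl.
rewrite mulrC -ltr_pdivlMr//; near: y.
by apply: cvgr_dist_lt => //; rewrite divr_gt0.
Unshelve. all: by end_near. Qed.

Lemma lipschitz_growth (R : realType) (K : R) (h : R -> R) : (forall u, 0 <= h u) ->
  (forall u v, `|h u - h v| <= K * `|u - v|) -> forall u, h u <= h 0 + K * `|u|.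
Proof.
move=> h0 hK u; rewrite -lerBlDl (le_trans (ler_norm _))// (le_trans (hK _ _))//.
by rewrite subr0.
Qed.

Lemma nnint_lty (R : realType) d (T : measurableType d) (P : probability T R)
    (f g : T -> R) (a b : R) : nnmeas f -> nnmeas g -> 0 <= a -> 0 <= b ->
  (forall w, f w <= a + b * g w) -> (\int[P]_w (g w)%:E < +oo)%E ->
  (\int[P]_w (f w)%:E < +oo)%E.
Proof.
move=> nf ng a0 b0 fg gfin.
have nbg : nnmeas (fun w => b * g w) by apply: nnmeasM => //; exact: nnmeas_cst.
have na : nnmeas (fun _ : T => a) by exact: nnmeas_cst.
apply: le_lt_trans (nnint_le P nf (nnmeasD na nbg) fg) _.
rewrite nnintD// nnintZ// nnint_cst lte_add_pinfty ?ltry//.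
by rewrite lte_mul_pinfty// ?lee_fin.
Qed.

Section projections.
Context {R : realType} {d : nat} {dT : measure_display} {T : measurableType dT}.
Context (P : probability T R).
Implicit Types (X : T -> Rd R d) (t : 'rV[R]_d).

Lemma measurable_coordX X i : measurable_fun setT X ->
  measurable_fun setT (fun w => (X w : 'rV[R]_d) 0 i).
Proof. by move=> mX; exact: (measurableT_comp (measurable_coord (R:=R) i) mX). Qed.

Lemma measurable_dotvX X t : measurable_fun setT X ->
  measurable_fun setT (fun w => dotv t (X w)).
Proof. by move=> mX; exact: (measurableT_comp (measurable_dotv t) mX). Qed.

Lemma nnmeas_enormX X : measurable_fun setT X -> nnmeas (fun w => enorm (X w)).
Proof. by move=> mX; apply: nnmeas_enorm => i; exact: measurable_coordX. Qed.

Lemma nnmeas_sumX X : measurable_fun setT X ->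
  nnmeas (fun w => \sum_i `|(X w : 'rV[R]_d) 0 i|).
Proof.
by move=> mX; apply: nnmeas_sum => i; apply: nnmeas_norm; exact: measurable_coordX.
Qed.

Lemma nnint_sum_lty X : measurable_fun setT X ->
  (forall i, \int[P]_w (`|(X w : 'rV[R]_d) 0 i|)%:E < +oo)%E ->
  (\int[P]_w (\sum_i `|(X w : 'rV[R]_d) 0 i|)%:E < +oo)%E.
Proof.
move=> mX Xfin; rewrite nnint_sum; last first.
  by move=> i; apply: nnmeas_norm; exact: measurable_coordX.
by apply: lte_sum_pinfty => i _; exact: Xfin.
Qed.

Lemma coord_nnint_lty X i : measurable_fun setT X ->
  (\int[P]_w (enorm (X w))%:E < +oo)%E ->
  (\int[P]_w (`|(X w : 'rV[R]_d) 0 i|)%:E < +oo)%E.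
Proof.
move=> mX; apply: le_lt_trans; apply: nnint_le.
- by apply: nnmeas_norm; exact: measurable_coordX.
- exact: nnmeas_enormX.
- by move=> w; exact: coord_le_enorm.
Qed.

Lemma ridge_lty X t K (h : R -> R) : measurable_fun setT X -> sphere R d t ->
  (forall i, \int[P]_w (`|(X w : 'rV[R]_d) 0 i|)%:E < +oo)%E ->
  (forall u, 0 <= h u) -> (forall u v, `|h u - h v| <= K * `|u - v|) ->
  nnmeas (fun w => h (dotv t (X w))) /\ (\int[P]_w (h (dotv t (X w)))%:E < +oo)%E.
Proof.
move=> mX t1 Xfin h0 hK.
have nh : nnmeas (fun w => h (dotv t (X w))).
  split=> // ; apply: (@measurableT_comp _ _ _ _ _ _ h); last exact: measurable_dotvX.
  by apply: continuous_measurable_fun; exact: lipschitz_continuous hK.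
split=> //.
apply: (nnint_lty (a := h 0) (b := K) nh (nnmeas_sumX mX)) => //.
- by have := le_trans (normr_ge0 _) (hK 1 0); rewrite subr0 normr1 mulr1.
- move=> w; apply: le_trans (lipschitz_growth h0 hK _) _.
  have K0 : 0 <= K by have := le_trans (normr_ge0 _) (hK 1 0); rewrite subr0 normr1 mulr1.
  rewrite lerD2l ler_wpM2l// (le_trans (dotv_le _ _))// t1 mul1r.
  exact: enorm_le_sum.
- exact: nnint_sum_lty.
Qed.

(** With [h >= 0] the integrals make sense whatever the moments of [Xn]. Integrability of [X] is
    asked coordinatewise, the form in which tails are summed. *)
Definition ridge_cvg X (Xn : nat -> T -> Rd R d) :=
  (forall i, \int[P]_w (`|(X w : 'rV[R]_d) 0 i|)%:E < +oo)%E /\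
  forall t K (h : R -> R), sphere R d t ->
    (forall u, 0 <= h u) -> (forall u v, `|h u - h v| <= K * `|u - v|) ->
    (\int[P]_w (h (dotv t (Xn n w)))%:E)%E @[n --> \oo] -->
    (\int[P]_w (h (dotv t (X w)))%:E)%E.

(** Two one-sided inequalities replace a bound on a difference, which could be infinite; one of them
    serves to prove that an integral is finite. *)
Lemma coupling_lipschitz (U V : T -> R) (lam : probability (R * R)%type R) K (h : R -> R) :
  measurable_fun setT U -> measurable_fun setT V -> coupling P U V lam ->
  (forall u, 0 <= h u) -> (forall u v, `|h u - h v| <= K * `|u - v|) ->
  (\int[P]_w (h (U w))%:E <= \int[P]_w (h (V w))%:E +
     K%:E * \int[lam]_z (`|z.1 - z.2|)%:E)%E /\
  (\int[P]_w (h (V w))%:E <= \int[P]_w (h (U w))%:E +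
     K%:E * \int[lam]_z (`|z.1 - z.2|)%:E)%E.
Proof.
move=> mU mV cpl h0 hK.
have K0 : 0 <= K by have := le_trans (normr_ge0 _) (hK 1 0); rewrite subr0 normr1 mulr1.
have nh : nnmeas (h : measurableTypeR R -> R).
  by split=> //; apply: continuous_measurable_fun; exact: lipschitz_continuous hK.
have [<- <-] := coupling_nnint mU mV cpl nh.
have nd := nnmeas_dist R.
have nKd : nnmeas (fun z : measurableTypeR R * measurableTypeR R => K * `|z.1 - z.2|).
  by apply: nnmeasM => //; exact: nnmeas_cst.
have nh1 : nnmeas (fun z : measurableTypeR R * measurableTypeR R => h z.1).
  exact: nnmeas_comp measurable_fst nh.
have nh2 : nnmeas (fun z : measurableTypeR R * measurableTypeR R => h z.2).
  exact: nnmeas_comp measurable_snd nh.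
rewrite -nnintZ// -!nnintD//; split; apply: nnint_le => //.
- exact: nnmeasD.
- by move=> z; have := ler_norm (h z.1 - h z.2); have := hK z.1 z.2; lra.
- exact: nnmeasD.
- move=> z; have := ler_norm (h z.2 - h z.1); have := hK z.1 z.2.
  by rewrite (distrC (h z.1)); lra.
Qed.

Lemma W1star_ridge_cvg X (Xn : nat -> T -> Rd R d) :
  measurable_fun setT X -> (forall n, measurable_fun setT (Xn n)) ->
  (forall n, \int[P]_w (enorm (Xn n w))%:E < +oo)%E ->
  W1star P (Xn n) X @[n --> \oo] --> 0%E -> ridge_cvg X Xn.
Proof.
move=> mX mXn Xnfin cv.
have near_cpl t (e : R) : sphere R d t -> 0 < e -> \forall n \near \oo,
    exists2 lam, coupling P (fun w => dotv t (Xn n w)) (fun w => dotv t (X w)) lam &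
      (\int[lam]_z (`|z.1 - z.2|)%:E <= e%:E)%E.
  move=> t1 e0; have e20 : 0 < e / 2 by rewrite divr_gt0.
  apply: filterS (cvge0_le cv e20) => n Wn.
  have : (W1r P (fun w => dotv t (Xn n w)) (fun w => dotv t (X w)) < e%:E)%E.
    apply: le_lt_trans (W1r_le_W1star _ _ _ t1) _; apply: le_lt_trans Wn _.
    by rewrite lte_fin; lra.
  by move=> /ereal_inf_lt[_ [lam /= cpl <-] lt]; exists lam => //; exact: ltW.
have norm_lip (u v : R) : `| `|u| - `|v| | <= 1 * `|u - v|.
  by rewrite mul1r; exact: ler_dist_dist.
(* A coupling of cost at most 1 with a single integrable [Xn n] already bounds the mean of the
   coordinate of [X]. *)
have Xfin i : (\int[P]_w (`|(X w : 'rV[R]_d) 0 i|)%:E < +oo)%E.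
  have [n _ /(_ n (leqnn _))] := near_cpl _ 1 (sphere_delta R i) ltr01.
  move=> [lam cpl lam1].
  have [_] := coupling_lipschitz (measurable_dotvX _ (mXn n)) (measurable_dotvX _ mX)
    cpl (@normr_ge0 _ _) norm_lip.
  under eq_integral do rewrite dotv_delta; move=> H; apply: le_lt_trans H _.
  under eq_integral do rewrite dotv_delta.
  rewrite mul1e lte_add_pinfty//; first exact: coord_nnint_lty.
  exact: le_lt_trans lam1 (ltry _).
split=> // t K h t1 h0 hK.
have K0 : 0 <= K by have := le_trans (normr_ge0 _) (hK 1 0); rewrite subr0 normr1 mulr1.
have [nh hfin] := ridge_lty mX t1 Xfin h0 hK.
have hE : (\int[P]_w (h (dotv t (X w)))%:E)%E \is a fin_num.
  by rewrite ge0_fin_numE// nnint_ge0.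
rewrite -(fineK hE); apply/cvge_boundsP => e e0.
(* [K] may be 0, so the division is by K + 1. *)
have e1 : 0 < e / (K + 1) by rewrite divr_gt0// ltr_wpDl.
apply: filterS (near_cpl t _ t1 e1) => n [lam cpl lame].
have [H1 H2] := coupling_lipschitz (measurable_dotvX _ (mXn n))
  (measurable_dotvX _ mX) cpl h0 hK.
have Ke : (K%:E * \int[lam]_z (`|z.1 - z.2|)%:E <= e%:E)%E.
  apply: (@le_trans _ _ (K%:E * (e / (K + 1))%:E)%E).
    by apply: lee_wpmul2l => //; rewrite lee_fin.
  rewrite -EFinM lee_fin mulrA ler_pdivrMr ?ltr_wpDl// mulrDr mulr1 mulrC.
  by rewrite lerDl ltW.
rewrite EFinB EFinD fineK// leeBlDr//; apply/andP; split.
  by apply: le_trans H2 _; rewrite leeD2l.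
by apply: le_trans H1 _; rewrite leeD2l.
Qed.

Lemma Dd_ridge_cvg X (Xn : nat -> T -> Rd R d) :
  measurable_fun setT X -> (forall n, measurable_fun setT (Xn n)) ->
  (forall f, Dd R d f ->
    (\int[P]_w (f (Xn n w))%:E)%E @[n --> \oo] --> (\int[P]_w (f (X w))%:E)%E /\
    (\int[P]_w (f (X w))%:E < +oo)%E) -> ridge_cvg X Xn.
Proof.
move=> mX mXn H; split=> [i|t K h t1 h0 hK].
  (* The finiteness clause for the test function |x_i| is the integrability of [X]. *)
  have /H[] // : Dd R d (fun x => `|x 0 i|).
  split.
    move=> x; apply: (@continuous_comp _ _ _ (fun x : 'rV[R]_d => x 0 i) Num.norm).
      exact: coord_continuous.
    exact: norm_continuous.
  exists 1 => z; rewrite normr_id mul1r le_max; apply/orP; right; exact: coord_le_enorm.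
have K0 : 0 <= K by have := le_trans (normr_ge0 _) (hK 1 0); rewrite subr0 normr1 mulr1.
have /H[] // : Dd R d (fun x => h (dotv t x)).
split.
  move=> x; apply: (@continuous_comp _ _ _ (dotv t) h); first exact: continuous_dotv.
  by have ch := lipschitz_continuous hK; exact: ch.
exists (h 0 + K) => z; rewrite ger0_norm//.
apply: le_trans (lipschitz_growth h0 hK _) _; rewrite mulrDl lerD//.
  by rewrite ler_peMr// le_max lexx.
rewrite ler_wpM2l// (le_trans (dotv_le _ _))// t1 mul1r le_max lexx orbT//.
Qed.

End projections.

(** Dominated convergence: at each point the tails vanish once L is large, and the sum of the |Y i|
    dominates them. *)
Lemma sum_tail_small (R : realType) dT (T : measurableType dT) (P : probability T R)
    (I : finType) (Y : I -> T -> R) (e : R) :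
  (forall i, measurable_fun setT (Y i)) ->
  (forall i, \int[P]_w (`|Y i w|)%:E < +oo)%E -> 0 < e ->
  exists2 L, 1 <= L & (\int[P]_w (\sum_i tail L (Y i w))%:E <= e%:E)%E.
Proof.
move=> mY Yfin e0; pose g w := \sum_i `|Y i w|.
have nY i : nnmeas (fun w => `|Y i w|) by exact: nnmeas_norm.
have ng : nnmeas g by exact: nnmeas_sum.
have ig : P.-integrable setT (fun w => (g w)%:E).
  apply/integrableP; split; first exact: nnmeas_meas.
  under eq_integral do rewrite gee0_abs ?nnmeas_ge0//.
  by rewrite nnint_sum//; apply: lte_sum_pinfty => i _; exact: Yfin.
pose S (n : nat) w := \sum_i tail n.+1%:R (Y i w).
have nS n : nnmeas (S n) by apply: nnmeas_sum => i; exact: nnmeas_tail.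
have Sg n w : S n w <= g w.
  apply: ler_sum => i _; rewrite /tail ge_max normr_ge0 andbT gerBl.
  by rewrite divr_ge0.
have pw : {ae P, forall w, setT w -> (S n w)%:E @[n --> \oo] --> cst 0%E w}.
  apply: aeW => w _; apply: cvg_near_cst; near=> n.
  congr EFin; apply: big1 => i _; rewrite /tail max_r// subr_le0.
  apply: (@le_trans _ _ (g w)); first by rewrite /g (bigD1 i)//= lerDl sumr_ge0.
  rewrite ler_pdivlMr//; near: n.
  exists (Num.truncn (g w * 2)) => // n /= gn.
  by apply: le_trans (ltW (truncnS_gt _)) _; rewrite ler_nat.
have dom : {ae P, forall w n, setT w -> (`|(S n w)%:E| <= (g w)%:E)%E}.
  by apply: aeW => w n _; rewrite gee0_abs ?nnmeas_ge0// lee_fin.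
have [_ _] := @dominated_convergence _ _ _ P setT measurableT
  (fun n w => (S n w)%:E) (cst 0%E) (fun w => (g w)%:E)
  (fun n => nnmeas_meas (nS n)) (measurable_cst _) pw ig dom.
rewrite integral_cst// mul0e => Scvg.
have [n _ /(_ n (leqnn n)) Sn] := cvge0_le Scvg e0.
by exists n.+1%:R => //; rewrite ler1n.
Unshelve. all: by end_near. Qed.

(** * From convergence of ridge functions to (i) and (iii) *)

Section from_ridges.
Context {R : realType} {d : nat} {dT : measure_display} {T : measurableType dT}.
Context (P : probability T R) (X : T -> Rd R d) (Xn : nat -> T -> Rd R d).
Hypotheses (mX : measurable_fun setT X) (mXn : forall n, measurable_fun setT (Xn n)).
Hypothesis H : ridge_cvg P X Xn.

Lemma cos_lipschitz (u v : R) : `|cos u - cos v| <= `|u - v|.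
Proof.
wlog uv : u v / v <= u.
  by move=> W; have [/W//|/ltW/W] := leP v u; rewrite distrC (distrC v).
have [c cI ->] := @MVT_segment R cos (fun x => - sin x) v u uv (fun x _ => is_derive_cos x)
  (continuous_subspaceT (@continuous_cos R)).
rewrite normrM ler_piMl// normrN ler_norml sin_geN1 sin_le1//.
Qed.

Lemma trig_measurable (f : 'rV[R]_d -> R) : trig f -> measurable_fun setT (f : Rd R d -> R).
Proof.
elim=> [t a|g h _ mg _ mh|c g _ mg]; [|exact: measurable_funD|exact: measurable_funM].
apply: (@measurableT_comp _ _ _ _ _ _ (@cos R)).
  by apply: continuous_measurable_fun; exact: continuous_cos.
by apply: measurable_funD => //; exact: measurable_dotv.
Qed.

Lemma trig_bounded (f : 'rV[R]_d -> R) : trig f -> exists C, forall x, `|f x| <= C.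
Proof.
elim=> [t a|g h _ [C Cg] _ [D Dh]|c g _ [C Cg]].
- by exists 1 => x; rewrite ler_norml cos_geN1 cos_le1.
- by exists (C + D) => x; apply: le_trans (ler_normD _ _) _; exact: lerD.
- by exists (`|c| * C) => x; rewrite normrM ler_wpM2l.
Qed.

Lemma trig_integrable (f : 'rV[R]_d -> R) (Z : T -> Rd R d) :
  trig f -> measurable_fun setT Z -> P.-integrable setT (fun w => (f (Z w))%:E).
Proof.
move=> tf mZ; have [C fC] := trig_bounded tf.
have mfZ : measurable_fun setT (fun w => f (Z w)).
  exact: (measurableT_comp (trig_measurable tf) mZ).
apply/integrableP; split; first exact/measurable_EFinP.
have C0 : 0 <= C by exact: le_trans (normr_ge0 _) (fC 0).
apply: le_lt_trans (ltry C); rewrite -(nnint_cst P C).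
by apply: (nnint_le P (nnmeas_norm mfZ)) => //; exact: nnmeas_cst.
Qed.

Lemma trig_cvg (f : 'rV[R]_d -> R) : trig f ->
  (\int[P]_w (f (Xn n w))%:E)%E @[n --> \oo] --> (\int[P]_w (f (X w))%:E)%E.
Proof.
elim=> [t a|g h tg IHg th IHh|c g tg IHg].
(* Frequency 0 has no direction on the sphere, but its cosine is constant. *)
- have [->|t0] := eqVneq t 0.
    have e0 x : dotv (0 : 'rV[R]_d) x = 0 by apply: big1 => i _; rewrite mxE mul0r.
    have E (Z : T -> Rd R d) :
        (\int[P]_w (cos (dotv 0 (Z w) + a))%:E = \int[P]_w (cos (0 + a))%:E)%E.
      by apply: eq_integral => w _; rewrite e0.
    rewrite E; under eq_fun do rewrite E.
    exact: cvg_cst.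
  have [s s1 ts] := sphere_normalize t0.
  (* Adding 1 makes the cosine an admissible nonnegative ridge function, with Lipschitz constant
     |t|; the 1 is subtracted again from the limit. *)
  pose h u := 1 + cos (enorm t * u + a).
  have h0 u : 0 <= h u by rewrite /h -lerBlDl sub0r cos_geN1.
  have hK u v : `|h u - h v| <= enorm t * `|u - v|.
    have -> : h u - h v = cos (enorm t * u + a) - cos (enorm t * v + a) by rewrite /h; ring.
    apply: le_trans (cos_lipschitz _ _) _.
    have -> : enorm t * u + a - (enorm t * v + a) = enorm t * (u - v) by ring.
    by rewrite normrM ger0_norm//; exact: enorm_ge0.
  have := H.2 s _ h s1 h0 hK.
  have E (Z : T -> Rd R d) : measurable_fun setT Z ->
      (\int[P]_w (cos (dotv t (Z w) + a))%:E =
       \int[P]_w (h (dotv s (Z w)))%:E + (-1)%:E)%E.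
    move=> mZ; have ic := trig_integrable (trig_cos t a) mZ.
    under [in RHS]eq_integral => w _ do rewrite /h -dotvZl -ts EFinD.
    rewrite integralD_EFin//; last exact: (trig_integrable (trig_cst d 1) mZ).
    have -> : (\int[P]_x 1%:E)%E = 1%E by exact: nnint_cst.
    by rewrite addeAC -EFinD subrr add0e.
  move=> hc; rewrite E//; under eq_fun do rewrite E//.
  apply: cvgeD; [by rewrite fin_num_adde_defl|exact: hc|exact: cvg_cst].
- have E (Z : T -> Rd R d) : measurable_fun setT Z ->
      (\int[P]_w (g (Z w) + h (Z w))%:E =
       \int[P]_w (g (Z w))%:E + \int[P]_w (h (Z w))%:E)%E.
    by move=> mZ; rewrite -integralD_EFin//; exact: trig_integrable.
  rewrite E//; under eq_fun do rewrite E//.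
  apply: cvgeD; [|exact: IHg|exact: IHh]; apply: fin_num_adde_defr.
  by apply: integrable_fin_num => //; exact: trig_integrable.
- have E (Z : T -> Rd R d) : measurable_fun setT Z ->
      (\int[P]_w (c * g (Z w))%:E = c%:E * \int[P]_w (g (Z w))%:E)%E.
    move=> mZ; rewrite -integralZl//; last exact: trig_integrable.
  rewrite E//; under eq_fun do rewrite E//.
  by apply: cvgeZl.
Qed.

Definition tails (L : R) (Z : T -> Rd R d) (w : T) : R :=
  \sum_i tail L ((Z w : 'rV[R]_d) 0 i).

Lemma nnmeas_tails L Z : measurable_fun setT Z -> nnmeas (tails L Z).
Proof. by move=> mZ; apply: nnmeas_sum => i; apply: nnmeas_tail; exact: measurable_coordX. Qed.

Lemma tail_lipschitz L (u v : R) : `|tail L u - tail L v| <= 1 * `|u - v|.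
Proof.
rewrite mul1r; apply: le_trans (ler_dist_dist u v); rewrite /tail.
move: (`|u|) (`|v|) => a b.
case: (leP (a - L / 2) 0) => ?; case: (leP (b - L / 2) 0) => ?.
- by rewrite subrr normr0.
- by rewrite sub0r normrN gtr0_norm// ler_normr; apply/orP; right; lra.
- by rewrite subr0 gtr0_norm// ler_normr; apply/orP; left; lra.
- by rewrite opprB addrA subrK.
Qed.

Lemma tails_cvg L : (\int[P]_w (tails L (Xn n) w)%:E)%E @[n --> \oo] -->
  (\int[P]_w (tails L X w)%:E)%E.
Proof.
have E (Z : T -> Rd R d) : measurable_fun setT Z -> (\int[P]_w (tails L Z w)%:E =
    \sum_i \int[P]_w (tail L (dotv (delta_mx 0 i) (Z w)))%:E)%E.
  move=> mZ; rewrite nnint_sum; last first.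
    by move=> i; apply: nnmeas_tail; exact: measurable_coordX.
  by apply: eq_bigr => i _; apply: eq_integral => w _; rewrite dotv_delta.
rewrite E//; under eq_fun do rewrite E//.
apply: cvg_nnesum => [i _|i _].
  apply: nearW => n; apply: nnint_ge0; apply: nnmeas_tail; exact: measurable_dotvX.
exact: (H.2 _ 1 (tail L) (sphere_delta R i) (@tail_ge0 _ L) (tail_lipschitz L)).
Qed.

Lemma tails_small (e : R) : 0 < e ->
  exists2 L, 1 <= L & (\int[P]_w (tails L X w)%:E <= e%:E)%E.
Proof.
move=> e0; have [L L1 tL] := sum_tail_small (fun i => measurable_coordX i mX) H.1 e0.
by exists L.
Qed.

(** This acts as uniform integrability: one [L] serves [X] and all late [Xn], because the tails are
    ridge functions along the axes. *)
Lemma tails_near (e : R) : 0 < e -> exists2 L, 1 <= L &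
  (\int[P]_w (tails L X w)%:E <= e%:E)%E /\
  \forall n \near \oo, (\int[P]_w (tails L (Xn n) w)%:E <= (2 * e)%:E)%E.
Proof.
move=> e0; have [L L1 tL] := tails_small e0; exists L => //; split=> //.
have tc := @tails_cvg L.
have tE : (\int[P]_w (tails L X w)%:E)%E \is a fin_num.
  rewrite ge0_fin_numE ?nnint_ge0//; first exact: le_lt_trans tL (ltry _).
  exact: nnmeas_tails.
rewrite -(fineK tE) in tc; move/cvge_boundsP : tc => /(_ e e0).
apply: filterS => n /andP[_ /le_trans]; apply.
by rewrite -(fineK tE) lee_fin in tL; rewrite lee_fin; lra.
Qed.

(** The cell masses of [Xn] converge to those of [X], as the weights are trigonometric polynomials.
    The leftover mass of the cell-by-cell coupling thus tends to 0, while cell size and tails were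
    made small beforehand. *)
Lemma ridge_W1_cvg : W1 P (Xn n) X @[n --> \oo] --> 0%E.
Proof.
apply: cvge_to0 => [n|e e0]; first by apply: W1c_ge0 => x y; exact: enorm_ge0.
(* Budget: one unit for the cell size, one for the leftover mass, and 5 (2 + 1) for the tails of
   [Xn] and [X], in all 17. *)
have e17 : 0 < e / 17 by rewrite divr_gt0.
have [L L1 [tX tXn]] := tails_near e17.
have L0 : 0 < L by rewrite (lt_le_trans ltr01).
pose D := d%:R * L + 1; have D0 : 0 < D by rewrite ltr_wpDl// mulr_ge0// ltW.
have DL : d%:R * L <= D by rewrite lerDl.
have dD : 0 < e / 17 / (2 * D) by rewrite divr_gt0// mulr_gt0.
have [m [z [z1 loc]]] := bern_sin_localized dD.
pose q (Z : T -> Rd R d) (f : {ffun 'I_d -> 'I_m.+1}) :=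
  (\int[P]_w (weight L f ((Z w : 'rV[R]_d) 0))%:E)%E.
have qcv f : fine (q (Xn n) f) @[n --> \oo] --> fine (q X f).
  have /trig_cvg := @trig_weight R d m L f.
  have qE : q X f \is a fin_num.
    by apply: integrable_fin_num => //; exact: (trig_integrable (trig_weight L f)).
  by rewrite -/(q X f) -(fineK qE) => /fine_cvgP[].
have qsum Z : measurable_fun setT Z -> \sum_f fine (q Z f) = 1.
  move=> mZ; have nw (f : {ffun 'I_d -> 'I_m.+1}) :
      nnmeas (fun w => weight L f ((Z w : 'rV[R]_d) 0)).
    have nwf := @nnmeas_weight R _ m L f _ T (fun i w => (Z w : 'rV[R]_d) 0 i)
      (fun i => measurable_coordX i mZ).
    exact: nwf.
  apply: EFin_inj; rewrite -sumEFin.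
  under eq_bigr => f _.
    rewrite fineK; last first.
      by apply: integrable_fin_num => //; exact: (trig_integrable (trig_weight L f)).
    over.
  rewrite -nnint_sum//.
  under eq_integral => w _ do rewrite weight_sum.
  exact: nnint_cst.
have mincv : \sum_f Num.min (fine (q (Xn n) f)) (fine (q X f)) @[n --> \oo] --> (1 : R).
  rewrite -(qsum X mX); apply: cvg_big => [|f _]; first by move=> x; exact: add_continuous.
  apply/cvgrPdist_le => a a0; near=> n.
  have : `|fine (q X f) - fine (q (Xn n) f)| <= a.
    by near: n; move/cvgrPdist_le : (qcv f); exact.
  apply: le_trans; rewrite /Num.min; case: ifP => // _.
  (* Here the minimum is the limit mass itself; in the other case it is the mass of [Xn], at
     distance at most [a]. *)
  by rewrite subrr normr0.
move/cvgrPdist_le : mincv => /(_ (e / 17 / D)); rewrite divr_gt0// => /(_ isT) mincv.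
near=> n.
have Sn : `|1 - \sum_f Num.min (fine (q (Xn n) f)) (fine (q X f))| <= e / 17 / D.
  by near: n; exact: mincv.
have tn : (\int[P]_w (tails L (Xn n) w)%:E <= (2 * (e / 17))%:E)%E by near: n.
have [Lam [l1 l2 lc]] := @box_coupling R _ T _ T P P 'I_d
  (fun i w => (Xn n w : 'rV[R]_d) 0 i) (fun i w => (X w : 'rV[R]_d) 0 i) m z _ L
  (fun i => measurable_coordX i (mXn n)) (fun i => measurable_coordX i mX) L0 z1 loc.
apply: (@le_trans _ _ (\int[Lam]_z (enorm (Xn n z.1 - X z.2))%:E)%E).
  apply: (@W1c_le_image _ _ _ _ _ (fun x y : Rd R d => enorm (x - y)) P (Xn n) X _ _ Lam
    (fun z => Xn n z.1) (fun z => X z.2)).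
  - exact: (measurableT_comp (mXn n) measurable_fst).
  - exact: (measurableT_comp mX measurable_snd).
  - exact: nnmeas_edist.
  - by move=> E mE; rewrite -l1//; rewrite -[X in measurable X]setTI; exact: mXn.
  - by move=> E mE; rewrite -l2//; rewrite -[X in measurable X]setTI; exact: mX.
apply: (@le_trans _ _ (\int[Lam]_w
    (\sum_i `|(Xn n w.1 : 'rV[R]_d) 0 i - (X w.2 : 'rV[R]_d) 0 i|)%:E)%E).
  apply: nnint_le => [||w].
  - apply: (@nnmeas_comp R _ (T * T)%type _ (Rd R d * Rd R d)%type
      (fun z : Rd R d * Rd R d => enorm (z.1 - z.2)) (fun z => (Xn n z.1, X z.2))).
      apply: measurable_fun_pair.
      + exact: (measurableT_comp (mXn n) measurable_fst).
      + exact: (measurableT_comp mX measurable_snd).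
    exact: nnmeas_edist.
  - apply: nnmeas_sum => i; apply: nnmeas_norm; apply: measurable_funB.
    + exact: (measurableT_comp (measurable_coordX i (mXn n)) measurable_fst).
    + exact: (measurableT_comp (measurable_coordX i mX) measurable_snd).
  - apply: le_trans (enorm_le_sum _) _.
    by under eq_bigr do rewrite !mxE.
apply: le_trans lc _; rewrite card_ord.
move/(le_trans (ler_norm _)) : Sn => Sn.
apply: (@le_trans _ _ ((2 * (e / 17))%:E + 5%:E * ((2 * (e / 17))%:E + (e / 17)%:E))%E).
  apply: leeD; last by apply: lee_wpmul2l; [rewrite lee_fin|exact: leeD].
  rewrite lee_fin.
  apply: (@le_trans _ _ (D * (2 * (e / 17 / (2 * D)) + e / 17 / D))).
    apply: (@le_trans _ _ (d%:R * L * (2 * (e / 17 / (2 * D)) + e / 17 / D))).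
      apply: ler_wpM2l; first by apply: mulr_ge0 => //; exact: ltW.
      by rewrite lerD2l; exact: Sn.
    apply: ler_wpM2r => //; apply: addr_ge0; last by apply: ltW; rewrite divr_gt0.
    by apply: mulr_ge0 => //; exact: ltW.
  rewrite le_eqVlt; apply/orP; left; apply/eqP; field.
  by rewrite gt_eqF.
by rewrite -!(EFinM, EFinD) lee_fin; lra.
Unshelve. all: by end_near. Qed.

Lemma trig_sum (I : Type) (s : seq I) (F : I -> 'rV[R]_d -> R) :
  (forall i, trig (F i)) -> trig (fun x => \sum_(i <- s) F i x).
Proof.
move=> tF; elim: s => [|i s IHs].
  by apply: trig_ext (trig_cst d 0) => x; rewrite big_nil.
by apply: trig_ext (trigD (tF i) IHs) => x; rewrite big_cons.
Qed.

Lemma Dd_integrable (f : 'rV[R]_d -> R) (Z : T -> Rd R d) :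
  Dd R d f -> measurable_fun setT Z ->
  (forall i, \int[P]_w (`|(Z w : 'rV[R]_d) 0 i|)%:E < +oo)%E ->
  P.-integrable setT (fun w => (f (Z w))%:E).
Proof.
move=> [cf [C fC]] mZ Zfin.
have mfZ : measurable_fun setT (fun w => f (Z w)).
  exact: (measurableT_comp (continuous_measurable_Rd cf) mZ).
have C0 : 0 <= C.
  by have := le_trans (normr_ge0 _) (fC 0); rewrite pmulr_lge0// lt_max ltr01.
apply/integrableP; split; first exact/measurable_EFinP.
apply: (nnint_lty (nnmeas_norm mfZ) (nnmeas_sumX mZ) C0 C0); last exact: nnint_sum_lty.
move=> w; apply: le_trans (fC _) _; rewrite -[X in X + _]mulr1 -mulrDr ler_wpM2l// ge_max.
by rewrite lerDl sumr_ge0//= (le_trans (enorm_le_sum _))// lerDr.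
Qed.

Lemma integral_close (a b c : T -> R) (e : R) :
  P.-integrable setT (fun w => (a w)%:E) -> P.-integrable setT (fun w => (b w)%:E) ->
  nnmeas c -> (forall w, `|a w - b w| <= c w) -> (\int[P]_w (c w)%:E <= e%:E)%E ->
  `|fine (\int[P]_w (a w)%:E)%E - fine (\int[P]_w (b w)%:E)%E| <= e.
Proof.
move=> ia ib nc abc ce.
have fa : (\int[P]_w (a w)%:E)%E \is a fin_num by exact: integrable_fin_num.
have fb : (\int[P]_w (b w)%:E)%E \is a fin_num by exact: integrable_fin_num.
rewrite -lee_fin; apply: le_trans ce.
have -> : (`|fine (\int[P]_w (a w)%:E) - fine (\int[P]_w (b w)%:E)|%:E =
    `| \int[P]_w ((a w)%:E - (b w)%:E) |)%E.
  by rewrite integralB_EFin// -(fineK fa) -(fineK fb).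
have mab : measurable_fun setT (fun w => ((a w)%:E - (b w)%:E)%E).
  by apply: emeasurable_funB; [exact: measurable_int ia|exact: measurable_int ib].
apply: le_trans (le_abse_integral _ measurableT mab) _.
apply: ge0_le_integral => //.
- exact: measurableT_comp.
- exact: nnmeas_meas.
- by move=> w _; rewrite -EFinB lee_fin.
Qed.

(** An epsilon/3 argument: a trigonometric polynomial [g] is close to [f] in mean under both [Xn]
    and [X], and the means of [g] converge. *)
Lemma ridge_Dd_cvg (f : 'rV[R]_d -> R) : Dd R d f ->
  (forall n i, \int[P]_w (`|(Xn n w : 'rV[R]_d) 0 i|)%:E < +oo)%E ->
  (\int[P]_w (f (Xn n w))%:E)%E @[n --> \oo] --> (\int[P]_w (f (X w))%:E)%E /\
  (\int[P]_w (f (X w))%:E < +oo)%E.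
Proof.
move=> Df Xnfin; have iX := Dd_integrable Df mX H.1.
have fX : (\int[P]_w (f (X w))%:E)%E \is a fin_num by exact: integrable_fin_num.
split; last by rewrite ltey_eq fX.
rewrite -(fineK fX); apply/cvge_boundsP => e e0.
have [C C0 approx] := Dd_approx Df.
have C1 : 0 < C + 1 by rewrite ltr_wpDl.
(* Replacing [f] by [g] costs e / 8 plus at most C times 2 e / 8 / (C + 1), so at most 3 e / 8 on
   each side; convergence for [g] costs e / 8 more. The total is 7 e / 8. *)
have e1 : 0 < e / 8 / (C + 1) by rewrite !divr_gt0.
have [L L1 [tX tXn]] := tails_near e1.
have e8 : 0 < e / 8 by rewrite divr_gt0.
have [delta delta0 {}approx] := approx L _ L1 e8.
have [m [z [z1 loc]]] := bern_sin_localized delta0.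
pose g (x : 'rV[R]_d) := \sum_(h : {ffun 'I_d -> 'I_m.+1})
  f (\row_i (L * z (h i))) * weight L h (x 0).
have fg (x : 'rV[R]_d) : `|f x - g x| <= e / 8 + C * \sum_i tail L (x 0 i).
  exact: approx m z z1 loc x.
have tg : trig g by apply: trig_sum => h; apply: trigZ; exact: trig_weight.
have close (Z : T -> Rd R d) (k : R) : measurable_fun setT Z -> 0 <= k <= 2 ->
    (forall i, \int[P]_w (`|(Z w : 'rV[R]_d) 0 i|)%:E < +oo)%E ->
    (\int[P]_w (tails L Z w)%:E <= (k * (e / 8 / (C + 1)))%:E)%E ->
    `|fine (\int[P]_w (f (Z w))%:E)%E - fine (\int[P]_w (g (Z w))%:E)%E| <= 3 * (e / 8).
  move=> mZ /andP[k0 k2] Zfin tZ.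
  have nt := nnmeas_tails L mZ.
  have nc : nnmeas (fun w => e / 8 + C * tails L Z w).
    apply: nnmeasD; first by apply: nnmeas_cst; exact: ltW.
    by apply: nnmeasM => //; exact: nnmeas_cst.
  apply: (integral_close (Dd_integrable Df mZ Zfin) (trig_integrable tg mZ) nc).
    by move=> w; exact: fg.
  rewrite nnintD; [|by apply: nnmeas_cst; exact: ltW|by apply: nnmeasM => //; exact: nnmeas_cst].
  rewrite nnint_cst nnintZ//.
  have -> : (3 * (e / 8))%:E = ((e / 8)%:E + (2 * (e / 8))%:E)%E.
    by rewrite -EFinD; congr EFin; ring.
  apply: leeD => //; apply: (@le_trans _ _ (C%:E * (k * (e / 8 / (C + 1)))%:E)%E).
    by apply: lee_wpmul2l => //; rewrite lee_fin.
  rewrite -EFinM lee_fin mulrCA; apply: ler_pM => //.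
    by rewrite mulr_ge0// ltW.
  by rewrite mulrA ler_pdivrMr// mulrDr mulr1 mulrC lerDl ltW.
have gE : (\int[P]_w (g (X w))%:E)%E \is a fin_num.
  by apply: integrable_fin_num => //; exact: trig_integrable.
have := trig_cvg tg; rewrite -(fineK gE) => /cvge_boundsP/(_ _ e8) gcv.
near=> n.
have tn : (\int[P]_w (tails L (Xn n) w)%:E <= (2 * (e / 8 / (C + 1)))%:E)%E by near: n.
have gn : ((fine (\int[P]_w (g (X w))%:E)%E - e / 8)%:E <= \int[P]_w (g (Xn n w))%:E <=
  (fine (\int[P]_w (g (X w))%:E)%E + e / 8)%:E)%E by near: n.
have fXn : (\int[P]_w (f (Xn n w))%:E)%E \is a fin_num.
  by apply: integrable_fin_num => //; exact: Dd_integrable.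
have gXn : (\int[P]_w (g (Xn n w))%:E)%E \is a fin_num.
  by apply: integrable_fin_num => //; exact: trig_integrable.
have c1 := close X 1 mX _ H.1 _; rewrite mul1r ler01 ler1n in c1; have {}c1 := c1 isT tX.
have c2 := close (Xn n) 2 (mXn n) _ (Xnfin n) tn; rewrite ler0n lexx in c2.
have {}c2 := c2 isT.
move: c1 c2 gn; rewrite -(fineK fXn) -(fineK gXn) !lee_fin /=.
move: (fine _) (fine _) (fine _) (fine _) => a b c x.
by rewrite !ler_norml => /andP[? ?] /andP[? ?] /andP[? ?]; apply/andP; split; lra.
Unshelve. all: by end_near. Qed.

End from_ridges.

(** * Gluing couplings *)

(** Equal laws give equal cell masses, so nothing is left over and only cell size and tails
    contribute to the cost. *)
Lemma approx_gluing (R : realType) d1 (T1 : measurableType d1) d2 (T2 : measurableType d2)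
    (P1 : probability T1 R) (P2 : probability T2 R) (Y1 : T1 -> R) (Y2 : T2 -> R) (e : R) :
  measurable_fun setT Y1 -> measurable_fun setT Y2 ->
  (forall A, measurable A -> P1 (Y1 @^-1` A) = P2 (Y2 @^-1` A)) ->
  (\int[P1]_w (`|Y1 w|)%:E < +oo)%E -> 0 < e ->
  exists L : probability (T1 * T2)%type R,
  [/\ forall A, measurable A -> L (fst @^-1` A) = P1 A,
      forall A, measurable A -> L (snd @^-1` A) = P2 A &
      (\int[L]_z (`|Y1 z.1 - Y2 z.2|)%:E <= e%:E)%E].
Proof.
move=> mY1 mY2 same fin1 e0.
(* The tails cost 5 (e / 20 + e / 20) = e / 2, and the cells cost 2 L (e / 4 / L) = e / 2. *)
have e20 : 0 < e / 20 by rewrite divr_gt0.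
have [L L1 tL] := @sum_tail_small _ _ _ P1 unit (fun=> Y1) _ (fun=> mY1) (fun=> fin1) e20.
have L0 : 0 < L by rewrite (lt_le_trans ltr01).
have eL : 0 < e / 4 / L by rewrite !divr_gt0.
have [m [z [z1 loc]]] := bern_sin_localized eL.
have [Lam [l1 l2 lc]] := @box_coupling R _ T1 _ T2 P1 P2 unit (fun=> Y1) (fun=> Y2) m z _ L
  (fun=> mY1) (fun=> mY2) L0 z1 loc.
exists Lam; split=> //.
have big_unit (V : nmodType) (F : unit -> V) : \sum_i F i = F tt.
  by rewrite (bigD1 tt)//= big1 ?addr0// => -[].
have lawE (c : measurableTypeR R -> R) : nnmeas c ->
    (\int[P2]_w (c (Y2 w))%:E = \int[P1]_w (c (Y1 w))%:E)%E.
  by move=> nc; apply: nnint_same_law => // A mA; exact/esym/same.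
have nt : nnmeas (fun u : measurableTypeR R => \sum_(i : unit) tail L u).
  by apply: nnmeas_sum => i; exact: nnmeas_tail.
have nw (f : {ffun unit -> 'I_m.+1}) :
    nnmeas (fun u : measurableTypeR R => weight L f (fun=> u)).
  have := @nnmeas_weight R unit m L f _ (measurableTypeR R) (fun i u => u)
    (fun=> @measurable_id _ _ setT).
  exact.
have nw1 (f : {ffun unit -> 'I_m.+1}) : nnmeas (fun w => weight L f (fun=> Y1 w)).
  exact: (@nnmeas_weight R unit m L f _ T1 (fun=> Y1) (fun=> mY1)).
have minE : \sum_(f : {ffun unit -> 'I_m.+1})
    Num.min (fine (\int[P1]_w (weight L f (fun=> Y1 w))%:E))
            (fine (\int[P2]_w (weight L f (fun=> Y2 w))%:E)) = 1.
  transitivity (\sum_(f : {ffun unit -> 'I_m.+1})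
    fine (\int[P1]_w (weight L f (fun=> Y1 w))%:E)).
    by apply: eq_bigr => f _; rewrite (lawE _ (nw f)) minxx.
  apply: EFin_inj; rewrite -sumEFin.
  under eq_bigr => f _.
    rewrite -nnint_fin//; last first.
      move=> w; rewrite -(weight_sum m L (fun _ : unit => Y1 w)) (bigD1 f)//= lerDl.
      by apply: sumr_ge0 => g _; exact: weight_ge0.
    over.
  rewrite -nnint_sum//.
  under eq_integral => w _ do rewrite (weight_sum m L (fun _ : unit => Y1 w)).
  exact: nnint_cst.
move: lc; rewrite card_unit mul1r (lawE _ nt) minE subrr addr0 => lc.
have E1 : (\int[Lam]_w (\sum_(i : unit) `|Y1 w.1 - Y2 w.2|)%:E =
    \int[Lam]_w (`|Y1 w.1 - Y2 w.2|)%:E)%E.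
  by apply: eq_integral => w _; rewrite big_unit.
rewrite -E1; apply: le_trans lc _.
apply: (@le_trans _ _ ((L * (2 * (e / 4 / L)))%:E + 5%:E * ((e / 20)%:E + (e / 20)%:E))%E).
  by apply: leeD => //; apply: lee_wpmul2l; [rewrite lee_fin|exact: leeD].
rewrite -!(EFinM, EFinD) lee_fin.
have -> : L * (2 * (e / 4 / L)) = e / 2 by field; rewrite gt_eqF.
lra.
Qed.

Lemma ler_distD4 (R : realDomainType) (a b c1 c2 v v' : R) :
  `|a - v'| <= `|a - b| + `|b - c1| + `|c1 - c2| + `|v - c2| + `|v - v'|.
Proof.
have := ler_distD b a v'; have := ler_distD c1 b v'.
have := ler_distD c2 c1 v'; have := ler_distD v c2 v'.
by rewrite (distrC c2 v); lra.
Qed.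

(** Triangle inequality along U', U, z.1, z.2, V, V' for a coupling of [U] and [V] with components
    z.1 and z.2. The outer links live on [T], the middle one on [R * R]; gluing puts all of them on
    one space. *)
Lemma W1r_perturb (R : realType) dT (T : measurableType dT) (P : probability T R)
    (U V U' V' : T -> R) :
  measurable_fun setT U -> measurable_fun setT V ->
  measurable_fun setT U' -> measurable_fun setT V' ->
  (\int[P]_w (`|U w|)%:E < +oo)%E -> (\int[P]_w (`|V w|)%:E < +oo)%E ->
  (W1r P U' V' <= W1r P U V +
    (\int[P]_w (`|U' w - U w|)%:E + \int[P]_w (`|V w - V' w|)%:E))%E.
Proof.
move=> mU mV mU' mV' Ufin Vfin.
set I1 := (\int[P]_w (`|U' w - U w|)%:E)%E; set I2 := (\int[P]_w (`|V w - V' w|)%:E)%E.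
have nU : nnmeas (fun w => `|U' w - U w|) by apply: nnmeas_norm; exact: measurable_funB.
have nV : nnmeas (fun w => `|V w - V' w|) by apply: nnmeas_norm; exact: measurable_funB.
have I10 : (0 <= I1)%E by exact: nnint_ge0.
have I20 : (0 <= I2)%E by exact: nnint_ge0.
(* The infimum over [lam] and the limit in [e] are taken at the end; moving [I1 + I2] across the
   inequality requires it to be finite. *)
suff key (lam : probability (R * R)%type R) (e : R) :
    coupling P U V lam -> 0 < e ->
    (W1r P U' V' <= \int[lam]_z (`|z.1 - z.2|)%:E + (I1 + I2) + e%:E)%E.
  have [Ifin|] := ltP (I1 + I2)%E +oo%E; last first.
    rewrite leye_eq => /eqP ->; rewrite addey ?leey// gt_eqF//.
    exact: lt_le_trans (ltNyr 0) (W1r_ge0 _ _ _).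
  have If : (I1 + I2)%E \is a fin_num by rewrite ge0_fin_numE// adde_ge0.
  rewrite -leeBlDr//; apply: le_ereal_inf_tmp => _ [lam /= cpl <-].
  rewrite leeBlDr//; apply/lee_addgt0Pr => e e0; exact: key.
move=> cpl e0; have e2 : 0 < e / 2 by rewrite divr_gt0.
(* [P] is glued to [lam] where [U] should meet the first component. *)
have [M [M1 M2 Mc]] := @approx_gluing R _ T _ (R * R)%type P lam
  U fst _ mU measurable_fst (fun A mA => esym (cpl A mA).1) Ufin e2.
have mz2 : measurable_fun setT (fun z : T * (R * R) => z.2.2).
  exact: (measurableT_comp measurable_snd measurable_snd).
have mz1 : measurable_fun setT (fun z : T * (R * R) => z.2.1).
  exact: (measurableT_comp measurable_fst measurable_snd).
have pre_snd (A : set R) : measurable A ->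
    measurable (snd @^-1` A : set (R * R)).
  by move=> mA; rewrite -[X in measurable X]setTI; exact: measurable_snd.
have same2 A : measurable A -> P (V @^-1` A) =
    M ((fun z : T * (R * R) => z.2.2) @^-1` A).
  by move=> mA; rewrite -(cpl A mA).2 -(M2 _ (pre_snd A mA)).
(* A second copy of [P] is glued on where [V] should meet the second component of [lam]. Under [N],
   U' is read on the inner copy of [T] and V' on the outer one. *)
have [N [N1 N2 Nc]] := @approx_gluing R _ T _
  (T * (R * R))%type P M V (fun z => z.2.2) _ mV mz2 same2 Vfin e2.
set S := (T * (T * (R * R)))%type in N N1 N2 Nc *.
have pre (A : set R) (F : T -> R) :
    measurable_fun setT F -> measurable A -> measurable (F @^-1` A).
  by move=> mF mA; rewrite -[X in measurable X]setTI; exact: mF.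
have preM (A : set T) : measurable A ->
    measurable (fst @^-1` A : set (T * (R * R))).
  by move=> mA; rewrite -[X in measurable X]setTI; exact: measurable_fst.
have mN1 : measurable_fun setT (fun s : S => s.2.1).
  exact: (measurableT_comp measurable_fst measurable_snd).
have nU' := @nnmeas_comp R _ (T * (R * R))%type _ T
  (fun w => `|U' w - U w|) fst measurable_fst nU.
have nUz : nnmeas (fun z : T * (R * R) => `|U z.1 - z.2.1|).
  apply: nnmeas_norm; apply: measurable_funB => //.
  exact: (measurableT_comp mU measurable_fst).
have nzz : nnmeas (fun z : T * (R * R) => `|z.2.1 - z.2.2|).
  by apply: nnmeas_norm; exact: measurable_funB.
pose F (z : T * (R * R)) :=
  (`|U' z.1 - U z.1| + `|U z.1 - z.2.1|) + `|z.2.1 - z.2.2|.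
have nF : nnmeas F by do 2?apply: nnmeasD.
have IF : (\int[M]_z (F z)%:E <= I1 + (e / 2)%:E + \int[lam]_z (`|z.1 - z.2|)%:E)%E.
  rewrite nnintD ?nnintD//; last exact: nnmeasD.
  apply: leeD; first apply: leeD.
  - rewrite (@nnint_same_law _ _ _ _ _ _ _ M P fst idfun (fun w => `|U' w - U w|))//.
    exact: measurable_id.
  - exact: Mc.
  - rewrite (@nnint_same_law _ _ _ _ _ _ _ M lam snd idfun (fun z => `|z.1 - z.2|))//;
      [exact: measurable_id|exact: nnmeas_dist].
have nF' : nnmeas (fun s : S => F s.2).
  exact: (@nnmeas_comp R _ S _ _ F snd measurable_snd nF).
have nVs : nnmeas (fun s : S => `|V s.1 - s.2.2.2|).
  apply: nnmeas_norm; apply: measurable_funB.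
    exact: (measurableT_comp mV measurable_fst).
  exact: (measurableT_comp mz2 measurable_snd).
have nV' : nnmeas (fun s : S => `|V s.1 - V' s.1|).
  exact: (@nnmeas_comp R _ S _ T (fun w => `|V w - V' w|) fst measurable_fst nV).
apply: (@le_trans _ _ (\int[N]_s (`|U' s.2.1 - V' s.1|)%:E)%E).
  apply: (@W1c_le_image _ _ _ _ _ (fun x y : R => `|x - y|) P U' V' _ _ N
    (fun s : S => U' s.2.1) (fun s : S => V' s.1)).
  - exact: (measurableT_comp mU' mN1).
  - exact: (measurableT_comp mV' measurable_fst).
  - exact: nnmeas_dist.
  - move=> A mA; rewrite -(M1 _ (pre A U' mU' mA)) -(N2 _ (preM _ (pre A U' mU' mA))) //.
  - by move=> A mA; rewrite -(N1 _ (pre A V' mV' mA)).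
apply: (@le_trans _ _ (\int[N]_s (F s.2 + `|V s.1 - s.2.2.2| + `|V s.1 - V' s.1|)%:E)%E).
  apply: nnint_le => [||s].
  - apply: nnmeas_norm; apply: measurable_funB.
      exact: (measurableT_comp mU' mN1).
    exact: (measurableT_comp mV' measurable_fst).
  - by do 2?apply: nnmeasD.
  - exact: ler_distD4.
rewrite nnintD//; last exact: nnmeasD.
rewrite nnintD// (@nnint_same_law _ _ _ _ _ _ _ N M snd idfun F)//; last exact: measurable_id.
rewrite (@nnint_same_law _ _ _ _ _ _ _ N P fst idfun (fun w => `|V w - V' w|))//;
  last exact: measurable_id.
apply: le_trans (leeD (leeD IF Nc) (lexx _)) _.
have -> : e%:E = ((e / 2)%:E + (e / 2)%:E)%E by rewrite -EFinD -splitr.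
by rewrite [leLHS](ACl (3 * (1 * 5) * (2 * 4))%AC).
Qed.

(** * Finite nets of projections *)

Section projection_nets.
Context {R : realType} {d : nat} {dT : measure_display} {T : measurableType dT}.
Context (P : probability T R) (X Y : T -> Rd R d).
Hypotheses (mX : measurable_fun setT X) (mY : measurable_fun setT Y).
Let EX := (\int[P]_w (enorm (X w))%:E)%E.
Let EY := (\int[P]_w (enorm (Y w))%:E)%E.
Let W (t : 'rV[R]_d) := W1r P (fun w => dotv t (X w)) (fun w => dotv t (Y w)).

Lemma dotv_nnint_le (Z : T -> Rd R d) (t : 'rV[R]_d) : measurable_fun setT Z ->
  (\int[P]_w (`|dotv t (Z w)|)%:E <= (enorm t)%:E * \int[P]_w (enorm (Z w))%:E)%E.
Proof.
move=> mZ; have nZ := nnmeas_enormX mZ.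
rewrite -nnintZ ?enorm_ge0//; apply: nnint_le => [||w].
- by apply: nnmeas_norm; exact: measurable_dotvX.
- by apply: nnmeasM => //; apply: nnmeas_cst; exact: enorm_ge0.
- exact: dotv_le.
Qed.

Lemma enorm_distC (s t : 'rV[R]_d) : enorm (s - t) = enorm (t - s).
Proof.
by congr Num.sqrt; apply: eq_bigr => i _; rewrite !mxE -sqrrN opprB.
Qed.

Lemma dotvBl (s t x : 'rV[R]_d) : dotv (s - t) x = dotv s x - dotv t x.
Proof. by rewrite -scaleN1r dotvDl dotvZl mulN1r. Qed.

Lemma W1r_proj_le (t : 'rV[R]_d) : sphere R d t -> (W t <= EX + EY)%E.
Proof.
move=> t1; have mtX := measurable_dotvX t mX; have mtY := measurable_dotvX t mY.
have nX : nnmeas (fun w => `|dotv t (X w)|) by exact: nnmeas_norm.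
have nY : nnmeas (fun w => `|dotv t (Y w)|) by exact: nnmeas_norm.
apply: (@le_trans _ _ (\int[P]_w (`|dotv t (X w) - dotv t (Y w)|)%:E)%E).
  by apply: (@W1c_le_image _ _ _ _ _ (fun x y : R => `|x - y|)) => //; exact: nnmeas_dist.
apply: (@le_trans _ _ (\int[P]_w (`|dotv t (X w)| + `|dotv t (Y w)|)%:E)%E).
  apply: nnint_le => [||w]; last exact: ler_normB.
  - by apply: nnmeas_norm; exact: measurable_funB.
  - exact: nnmeasD.
rewrite nnintD//; apply: leeD.
- by apply: le_trans (dotv_nnint_le t mX) _; rewrite t1 mul1e.
- by apply: le_trans (dotv_nnint_le t mY) _; rewrite t1 mul1e.
Qed.

(** Moving the direction from t to s displaces t'x by (s - t)'x, of size at most |s - t| |x|;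
    [W1r_perturb] turns this into a bound on the distances. *)
Lemma W1r_proj_continuity (s t : 'rV[R]_d) : sphere R d t ->
  (EX < +oo)%E -> (EY < +oo)%E ->
  (W s <= W t + (enorm (s - t))%:E * (EX + EY))%E.
Proof.
move=> t1 EXfin EYfin.
have fin (Z : T -> Rd R d) : measurable_fun setT Z ->
    (\int[P]_w (enorm (Z w))%:E < +oo -> \int[P]_w (`|dotv t (Z w)|)%:E < +oo)%E.
  move=> mZ Zfin; apply: le_lt_trans (dotv_nnint_le t mZ) _.
  by rewrite t1 mul1e.
have := W1r_perturb (measurable_dotvX t mX) (measurable_dotvX t mY)
  (measurable_dotvX s mX) (measurable_dotvX s mY) (fin X mX EXfin) (fin Y mY EYfin).
move=> H; apply: le_trans H _; apply: leeD => //.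
have EX0 : (0 <= EX)%E by apply: nnint_ge0; exact: nnmeas_enormX.
have EY0 : (0 <= EY)%E by apply: nnint_ge0; exact: nnmeas_enormX.
rewrite ge0_muleDr//; apply: leeD.
  under eq_integral do rewrite -dotvBl.
  exact: dotv_nnint_le.
under eq_integral do rewrite -dotvBl.
by rewrite enorm_distC; exact: dotv_nnint_le.
Qed.

(** The net lies in the sphere, which gives one inequality; the other is the Lipschitz dependence of
    [W] on the direction. If a first moment is infinite, the right-hand side is [+oo]. *)
Lemma W1star_net (eps : R) (Teps : seq 'rV[R]_d) : (1 <= d)%N -> 0 < eps ->
  (forall t, t \in Teps -> t \in sphere R d) ->
  (ereal_sup [set ereal_inf [set (enorm (s - t))%:E | t in [set t | t \in Teps]]
             | s in sphere R d] <= eps%:E)%E ->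
  (`| W1star P X Y - ereal_sup [set W t | t in [set t | t \in Teps]] |
    <= eps%:E * (EX + EY))%E.
Proof.
move=> d1 eps0 TS net.
have TSP t : t \in Teps -> sphere R d t by move=> /TS; rewrite inE.
have EX0 : (0 <= EX)%E by apply: nnint_ge0; exact: nnmeas_enormX.
have EY0 : (0 <= EY)%E by apply: nnint_ge0; exact: nnmeas_enormX.
have [Efin|] := ltP (EX + EY)%E +oo%E; last first.
  by rewrite leye_eq => /eqP ->; rewrite gt0_muley ?lte_fin// leey.
have EXfin : (EX < +oo)%E by apply: le_lt_trans Efin; rewrite leeDl.
have EYfin : (EY < +oo)%E by apply: le_lt_trans Efin; rewrite leeDr.
have EE : (EX + EY)%E \is a fin_num by rewrite ge0_fin_numE// adde_ge0.
set E := fine (EX + EY)%E.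
have E0 : 0 <= E by rewrite fine_ge0// adde_ge0.
(* The slack [e] extracts a point of the net from the infimum; it is sent to 0 afterwards. *)
have near_net s e : sphere R d s -> 0 < e ->
    exists2 t, t \in Teps & enorm (s - t) < eps + e.
  move=> s1 e0.
  have : (ereal_inf [set (enorm (s - t))%:E | t in [set t | t \in Teps]] < (eps + e)%:E)%E.
    apply: (@le_lt_trans _ _ eps%:E); last by rewrite lte_fin ltrDl; exact: e0.
    by apply: le_trans net; apply: ereal_sup_ubound; exists s.
  by move=> /ereal_inf_lt[_ [t /= tT <-]]; rewrite lte_fin => st; exists t.
set supT := ereal_sup [set W t | t in [set t | t \in Teps]].
have supT_le : (supT <= W1star P X Y)%E.
  apply: ge_ereal_sup => _ [t /= tT <-]; apply: ereal_sup_ubound.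
  by exists t => //; exact: TSP.
have le_supT t : t \in Teps -> (W t <= supT)%E.
  by move=> tT; apply: ereal_sup_ubound; exists t.
have supT0 : (0 <= supT)%E.
  (* Over an empty net the infimum would be [+oo], so the hypothesis supplies a point, which keeps
     the supremum from being [-oo]. *)
  have [t tT _] := near_net _ 1 (sphere_delta R (Ordinal d1)) ltr01.
  exact: le_trans (W1r_ge0 _ _ _) (le_supT t tT).
have star_le : (W1star P X Y <= supT + eps%:E * (EX + EY))%E.
  apply: ge_ereal_sup => _ [s /= s1 <-]; apply/lee_addgt0Pr => e e0.
  have e1 : 0 < e / (E + 1) by rewrite divr_gt0// ltr_wpDl.
  have [t tT st] := near_net s _ s1 e1.
  apply: le_trans (W1r_proj_continuity s (TSP t tT) EXfin EYfin) _.
  rewrite -[leRHS]addeA; apply: leeD; first exact: le_supT.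
  rewrite -(fineK EE) -/E -!EFinM -EFinD lee_fin.
  apply: (@le_trans _ _ ((eps + e / (E + 1)) * E)); first by rewrite ler_wpM2r// ltW.
  rewrite mulrDl lerD2l mulrAC ler_pdivrMr ?ltr_wpDl// mulrDr mulr1 lerDl.
  exact: ltW.
have starfin : W1star P X Y \is a fin_num.
  rewrite ge0_fin_numE; last exact: W1star_ge0.
  apply: le_lt_trans Efin; apply: ge_ereal_sup => _ [t t1 <-]; exact: W1r_proj_le.
have supTfin : supT \is a fin_num.
  rewrite ge0_fin_numE//; apply: le_lt_trans supT_le _.
  by rewrite ltey_eq starfin.
rewrite gee0_abs; first by rewrite leeBlDr// [leRHS]addeC.
by rewrite sube_ge0 ?supTfin.
Qed.

End projection_nets.

Theorem theorem8 (R : realType) (d : nat) (hd : (1 <= d)%N)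
  (dT : measure_display) (T : measurableType dT) (P : probability T R) :
  (* (a) *)
  (forall (X : T -> Rd R d) (Xn : nat -> T -> Rd R d),
    measurable_fun setT X ->
    (forall n, measurable_fun setT (Xn n)) ->
    (forall n, (\int[P]_w (enorm (Xn n w))%:E < +oo)%E) ->
    ((W1 P (Xn n) X @[n --> \oo] --> 0%E) <->
     (W1star P (Xn n) X @[n --> \oo] --> 0%E)) /\
    ((W1star P (Xn n) X @[n --> \oo] --> 0%E) <->
     (forall f, Dd R d f ->
        ((\int[P]_w (f (Xn n w))%:E)%E @[n --> \oo] --> (\int[P]_w (f (X w))%:E)%E)
        /\ (\int[P]_w (f (X w))%:E < +oo)%E))) /\
  (* (b) *)
  (forall (X Y : T -> Rd R d) (eps : R) (Teps : seq 'rV[R]_d),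
    measurable_fun setT X -> measurable_fun setT Y ->
    0 < eps ->
    (forall t, t \in Teps -> t \in sphere R d) ->
    (ereal_sup [set ereal_inf [set (enorm (s - t))%:E
                              | t in [set t | t \in Teps]]
               | s in sphere R d] <= eps%:E)%E ->
    (`| W1star P X Y
        - ereal_sup [set W1r P (fun w => dotv t (X w)) (fun w => dotv t (Y w))
                    | t in [set t | t \in Teps]] |
      <= eps%:E * (\int[P]_w (enorm (X w))%:E + \int[P]_w (enorm (Y w))%:E))%E).
Proof.
split; last by move=> X Y eps Teps mX mY; exact: W1star_net.
move=> X Xn mX mXn Xnfin.
have W1_star : W1 P (Xn n) X @[n --> \oo] --> 0%E -> W1star P (Xn n) X @[n --> \oo] --> 0%E.
  apply: cvge0_dominated => n.
  by rewrite W1star_ge0// W1star_le_W1.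
have star_ridge := W1star_ridge_cvg mX mXn Xnfin.
split; split=> //.
- by move=> /star_ridge; exact: ridge_W1_cvg.
- move=> /star_ridge cv f Df; apply: (ridge_Dd_cvg mX mXn cv Df) => n i.
  exact: coord_nnint_lty.
- by move=> /(Dd_ridge_cvg mX mXn)/(ridge_W1_cvg mX mXn); exact: W1_star.
Qed.
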